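(* Let $\pi\in\mathcal M_+^1(\Theta)$ be a prior distribution, let $\epsilon\in(0,1)$ and let $\nu\in\mathcal M_+^1(\mathbb R_+)$ be any atomic probability distribution on the positive real line. With $\mathbb P$ probability at least $1-\epsilon$, for any posterior distribution $\rho:\Omega\to\mathcal M_+^1(\Theta)$ and any positive real constants $\beta$ and $\gamma$, $$\bigl[N\tanh(\tfrac{\gamma}{N})-\beta\bigr]\bigl[\rho(R)-\pi_{\exp(-\beta R)}(R)\bigr]\le F_{\gamma,\beta}\bigl[\rho(R)-\pi_{\exp(-\beta R)}(R)\bigr]\le B(\rho,\beta,\gamma),$$ where, writing $\nu(\beta)=\nu(\{\beta\})$, $\nu(\gamma)=\nu(\{\gamma\})$, $$\begin{aligned}B(\rho,\beta,\gamma)=\inf_{\lambda_1,\lambda_2}\Bigl\{&\mathcal K\bigl[\rho,\pi_{\exp(-\lambda_1 r)}\bigr]+(\gamma-\lambda_1)\bigl[\rho(r)-\pi_{\exp(-\lambda_2 r)}(r)\bigr]\\&+\log\Bigl\{\pi_{\exp(-\lambda_1 r)}\Bigl[\exp\bigl\{N\log[\cosh(\tfrac{\gamma}{N})]\,\rho(m')\bigr\}\Bigr]\Bigr\}-\log[\epsilon\nu(\beta)\nu(\gamma)]\\&+(\gamma-\lambda_1)\tfrac{\beta}{\lambda_2}F^{-1}_{\gamma,\frac{\beta\gamma}{\lambda_2}}\Bigl[\log\Bigl\{\pi_{\exp(-\lambda_2 r)}\Bigl[\exp\bigl\{N\log[\cosh(\tfrac{\gamma}{N})]\,\pi_{\exp(-\lambda_2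 r)}(m')\bigr\}\Bigr]\Bigr\}-\log[\epsilon\nu(\beta)\nu(\gamma)]\Bigr]\Bigr\},\end{aligned}$$ the infimum being taken over $\lambda_1\in\mathbb R_+$ with $\lambda_1\le\gamma$ and $\lambda_2\in\mathbb R$ with $\lambda_2>\frac{\beta\gamma}{N}\tanh(\frac{\gamma}{N})^{-1}$. Moreover $$\begin{aligned}B(\rho,\beta,\gamma)\le\inf_{\lambda_1,\lambda_2}\Bigl\{&\mathcal K\bigl[\rho,\pi_{\exp(-\lambda_1 r)}\bigr]+(\gamma-\lambda_1)\bigl[\rho(r)-\pi_{\exp(-\lambda_2 r)}(r)\bigr]\\&+\log\Bigl\{\pi_{\exp(-\lambda_1 r)}\Bigl[\exp\bigl\{N\log[\cosh(\tfrac{\gamma}{N})]\,\rho(m')\bigr\}\Bigr]\Bigr\}\\&+\frac{\beta}{\lambda_2}\frac{1-\frac{\lambda_1}{\gamma}}{\frac N\gamma\tanh(\frac\gamma N)-\frac{\beta}{\lambda_2}}\log\Bigl\{\pi_{\exp(-\lambda_2 r)}\Bigl[\exp\bigl\{N\log[\cosh(\tfrac{\gamma}{N})]\,\pi_{\exp(-\lambda_2 r)}(m')\bigr\}\Bigr]\Bigr\}\\&-\Bigl\{1+\frac{\beta}{\lambda_2}\frac{1-\frac{\lambda_1}{\gamma}}{\frac N\gamma\tanh(\frac\gamma N)-\frac{\beta}{\lambda_2}}\Bigr\}\log[\epsilon\nu(\beta)\nu(\gamma)]\Bigr\},\end{aligned}$$ with the same range for the infimum.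
   Context: Setting. $N\ge 1$ is an integer, $(\mathcal X,\mathcal B)$ a measurable space, $\mathcal Y$ a finite set with the algebra of all its subsets. $\Omega=(\mathcal X\times\mathcal Y)^N$ with coordinate process $(X_i,Y_i)_{i=1}^N$, and $\mathbb P=\bigotimes_{i=1}^N P_i$ is a product probability measure on $\Omega$ (the $P_i$ are arbitrary probability measures on $\mathcal X\times\mathcal Y$). $(\Theta,\mathcal T)$ is a measurable space and $\{f_\theta:\mathcal X\to\mathcal Y;\theta\in\Theta\}$ a family of classification rules such that $(\theta,x)\mapsto f_\theta(x)$ is measurable. $\sigma$-algebras are countably generated. Notation: $R(\theta)=\frac1N\sum_{i=1}^N\mathbb P[f_\theta(X_i)\ne Y_i]$, $r(\theta)=\frac1N\sum_{i=1}^N\mathbf 1[f_\theta(X_i)\neq Y_i]$ and $$m'(\theta,\theta')=\frac1N\sum_{i=1}^N\bigl|\mathbf 1[f_\theta(X_i)\ne Y_i]-\mathbf 1[f_{\theta'}(X_i)\ne Y_i]\bigr|.$$ $\mathcal M_+^1(\Theta)$ is the set of probability measures on $(\Theta,\mathcal T)$; a prior does not depend on the sample; a posterior distribution $\rho:\Omega\to\mathcal M_+^1(\Theta)$ is a regular conditional probability measure. For a probability measure $\rho$ and a function $h$, $\rho(h)=\int h\,d\rho$; $\rho(m')$ denotes the function $\theta\mapsto\int m'(\theta,\theta')\rho(d\theta')$. $\mathcal K(\rho,\pi)=\int\log\frac{d\rho}{d\pi}d\rho$ if $\rho\ll\pi$ and $+\infty$ otherwise. For bounded measurable $h$, $\pi_{\exp(h)}$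 has density $\frac{d\pi_{\exp(h)}}{d\pi}=\frac{\exp(h)}{\pi[\exp(h)]}$. $F_{\gamma,\alpha}(x)=-N\log[1-\tanh(\frac\gamma N)x]-\alpha x$. When $\alpha<N\tanh(\frac\gamma N)$, $F_{\gamma,\alpha}$ is an increasing bijection from $[0,\tanh(\gamma/N)^{-1})$ onto $[0,+\infty)$ and $F_{\gamma,\alpha}^{-1}$ denotes its inverse. By convention $-\log 0=+\infty$, so that $B(\rho,\beta,\gamma)=+\infty$ when $\nu(\beta)=0$ or $\nu(\gamma)=0$. ''With $\mathbb P$ probability at least $1-\epsilon$, for any $\rho,\beta,\gamma$'' means that there is one event of probability at least $1-\epsilon$ on which the inequalities hold simultaneously for all these objects. *)

(* Defs.v *)
From HB Require Import structures.
From mathcomp Require Export all_boot all_order all_algebra.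
From mathcomp Require Export all_classical all_reals all_analysis.
From mathcomp Require Export measurable_realfun.

Set Implicit Arguments.
Unset Strict Implicit.
Unset Printing Implicit Defensive.

Import Order.TTheory GRing.Theory Num.Theory.
Import numFieldNormedType.Exports.

Local Open Scope classical_set_scope.
Local Open Scope ring_scope.

Definition cosh (R : realType) (x : R) : R := (expR x + expR (- x)) / 2.

Definition tanh (R : realType) (x : R) : R :=
  (expR x - expR (- x)) / (expR x + expR (- x)).

Definition countably_generated (d : measure_display) (T : measurableType d) :
    Prop :=
  exists G : set (set T), countable G /\ (measurable : set (set T)) = <<s G >>.

(* Countable subsets of R are Borel, so the evaluation below is meaningful. *)
Definition atomic (R : realType) (nu : probability (measurableTypeR R) R) :
    Prop :=
  exists A : set R, countable A /\ nu A = 1%E.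

(* This determines Q among the probability measures on the product space. *)
Definition is_product_measure (d : measure_display) (T : measurableType d)
    (R : realType) (N : nat) (Pi : 'I_N -> probability T R)
    (Q : probability (N.-tuple T) R) : Prop :=
  forall A : 'I_N -> set T, (forall i, measurable (A i)) ->
    Q [set w | forall i, A i (tnth w i)] = (\prod_(i < N) Pi i (A i))%E.

Section gibbs.
Context (d : measure_display) (T : measurableType d) (R : realType).
Variables (pi : probability T R) (h : T -> R).
Local Open Scope ereal_scope.

(* The fallback makes tilt a measure for every h; see gibbsE for the case of
   interest. *)
Definition tilt_weight : T -> R :=
  if `[< measurable_fun [set: T] h >] then (fun x => expR (h x)) else cst 1%R.

Let measurable_tilt_weight : measurable_fun [set: T] tilt_weight.
Proof.
rewrite /tilt_weight; case: asboolP => mh; last exact: measurable_cst.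
exact: measurableT_comp.
Qed.

Let tilt_weight_ge0 x : (0 <= tilt_weight x)%R.
Proof. by rewrite /tilt_weight; case: asboolP => // _; exact: expR_ge0. Qed.

Definition tilt (A : set T) : \bar R := \int[pi]_(x in A) (tilt_weight x)%:E.

Let tilt0 : tilt set0 = 0.
Proof. exact: integral_set0. Qed.

Let tilt_ge0 A : 0 <= tilt A.
Proof. by apply: integral_ge0 => x _; rewrite lee_fin. Qed.

Let tilt_sigma_additive : semi_sigma_additive tilt.
Proof.
move=> F mF tF mUF; rewrite /tilt ge0_integral_bigcup//; last first.
- by move=> x _; rewrite lee_fin.
- by apply/measurable_EFinP; exact: measurable_funTS.
apply: is_cvg_ereal_nneg_natsum_cond => n _ _.
exact: tilt_ge0.
Qed.

HB.instance Definition _ := isMeasure.Build _ _ _ tilt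
  tilt0 tilt_ge0 tilt_sigma_additive.

Definition gibbs : probability T R := mnormalize tilt pi.

Lemma gibbsE (A : set T) : measurable A -> measurable_fun [set: T] h ->
  (exists M : R, forall x, (`|h x| <= M)%R) ->
  gibbs A = \int[pi]_(x in A) (expR (h x) / \int[pi]_y expR (h y))%:E.
Proof.
move=> mA mh [M hM].
have tw : tilt_weight = (fun x => expR (h x)).
  by rewrite /tilt_weight; case: asboolP.
have meh : measurable_fun [set: T] (fun x => expR (h x)).
  exact: measurableT_comp.
have Zge : ((expR (- M))%:E <= tilt [set: T])%E.
  rewrite /tilt tw.
  have -> : ((expR (- M))%:E = \int[pi]_(x in [set: T]) (expR (- M))%:E)%E.
    by rewrite integral_cst//= probability_setT mule1.
  apply: ge0_le_integral => //.
  - exact/measurable_EFinP.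
  - move=> x _; rewrite lee_fin ler_expR lerNl.
    by apply: le_trans (hM x); rewrite -normrN ler_norm.
have Zle : (tilt [set: T] <= (expR M)%:E)%E.
  rewrite /tilt tw.
  have -> : ((expR M)%:E = \int[pi]_(x in [set: T]) (expR M)%:E)%E.
    by rewrite integral_cst//= probability_setT mule1.
  apply: ge0_le_integral => //.
  - exact/measurable_EFinP.
  - by move=> x _; rewrite lee_fin ler_expR (le_trans (ler_norm _)).
have Z0 : (tilt [set: T] == 0)%E = false.
  by apply/gt_eqF/(lt_le_trans _ Zge); rewrite lte_fin expR_gt0.
have Zoo : (tilt [set: T] == +oo)%E = false.
  by apply/lt_eqF/(le_lt_trans Zle); rewrite ltry.
rewrite /gibbs /= /mnormalize /= Z0 Zoo /=.
have -> : fine (tilt [set: T]) = (\int[pi]_y expR (h y))%R.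
  by rewrite /Rintegral /tilt tw.
rewrite {1}/tilt tw -ge0_integralZr//.
- exact/measurable_EFinP/measurable_funTS.
- rewrite lee_fin invr_ge0 /Rintegral fine_ge0//.
  by apply: integral_ge0 => x _; rewrite lee_fin expR_ge0.
Qed.

End gibbs.

Definition KL (d : measure_display) (T : measurableType d) (R : realType)
    (rho pi : probability T R) : \bar R :=
  if `[< rho `<< pi >] then
    (\int[rho]_x
      (ln (fine (Radon_Nikodym (charge_of_finite_measure rho) pi x)))%:E)%E
  else +oo%E.

(* The library only types the values of a probability kernel as measures. *)
Section kernel_at.
Context (d d' : measure_display) (T : measurableType d) (U : measurableType d').
Context (R : realType) (k : R.-pker T ~> U) (x : T).

Definition kernel_at : set U -> \bar R := k x.

HB.instance Definition _ := Measure.on kernel_at.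

Let kernel_at_setT : kernel_at [set: U] = 1%E.
Proof. exact: prob_kernel. Qed.

HB.instance Definition _ :=
  Measure_isProbability.Build _ _ _ kernel_at kernel_at_setT.

End kernel_at.

Section learning.
Context (R : realType) (N : nat) (dX dY dT : measure_display).
Context (X : measurableType dX) (Y : measurableType dY).
Context (Theta : measurableType dT).

Definition sample := N.-tuple (X * Y)%type.

Variable f : Theta -> X -> Y.

Definition risk (P : probability sample R) (theta : Theta) : R :=
  N%:R^-1 * \sum_(i < N)
    fine (P [set w : sample | f theta (tnth w i).1 != (tnth w i).2]).

Definition err (w : sample) (theta : Theta) (i : 'I_N) : R :=
  (f theta (tnth w i).1 != (tnth w i).2)%:R.

Definition emp_risk (w : sample) (theta : Theta) : R :=
  N%:R^-1 * \sum_(i < N) err w theta i.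

Definition emp_dist (w : sample) (theta theta' : Theta) : R :=
  N%:R^-1 * \sum_(i < N) `|err w theta i - err w theta' i|.

Definition F (gamma alpha x : R) : R :=
  - (N%:R * ln (1 - tanh (gamma / N%:R) * x)) - alpha * x.

(* F^-1, extended by its limit tanh(gamma/N)^-1 at +oo; this is only reached
   when nu(beta) nu(gamma) = 0, in which case bound below is +oo anyway. *)
Definition Finv (gamma alpha : R) (y : \bar R) : R :=
  match y with
  | y%:E => 'pinv_(fun=> 0) `[0, (tanh (gamma / N%:R))^-1[ (F gamma alpha) y
  | +oo%E => (tanh (gamma / N%:R))^-1
  | -oo%E => 0
  end.

Variable pi : probability Theta R.

(* rho(R) - pi_{exp(-beta R)}(R) *)
Definition risk_gap (P : probability sample R) (beta : R)
    (rho : probability Theta R) : R :=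
  \int[rho]_t risk P t
  - \int[gibbs pi (fun t => - beta * risk P t)]_t risk P t.

(* pi_{exp(-lambda r)} *)
Definition emp_gibbs (w : sample) (lambda : R) : probability Theta R :=
  gibbs pi (fun t => - lambda * emp_risk w t).

(* log pi_{exp(-lambda r)}[exp(N log(cosh(gamma/N)) rho(m'))] *)
Definition log_lap (w : sample) (gamma lambda : R) (rho : probability Theta R) :
    R :=
  ln (\int[emp_gibbs w lambda]_t
        expR (N%:R * ln (cosh (gamma / N%:R)) * \int[rho]_t' emp_dist w t t')).

(* log[eps nu(beta) nu(gamma)], equal to -oo when the product vanishes *)
Definition log_weight (nu : probability (measurableTypeR R) R)
    (eps beta gamma : R) : \bar R :=
  lne (eps%:E * nu [set beta] * nu [set gamma])%E.

Definition lambda_range (beta gamma : R) : set (R * R) :=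
  [set l | [/\ 0 <= l.1, l.1 <= gamma &
    beta * gamma / N%:R * (tanh (gamma / N%:R))^-1 < l.2]].

Definition common_terms (w : sample) (rho : probability Theta R)
    (gamma l1 l2 : R) : \bar R :=
  (KL rho (emp_gibbs w l1)
   + ((gamma - l1) * (\int[rho]_t emp_risk w t
                      - \int[emp_gibbs w l2]_t emp_risk w t))%:E
   + (log_lap w gamma l1 rho)%:E)%E.

Definition bound (nu : probability (measurableTypeR R) R) (eps : R)
    (w : sample) (rho : probability Theta R) (beta gamma : R) : \bar R :=
  ereal_inf [set (common_terms w rho gamma l.1 l.2
      - log_weight nu eps beta gamma
      + ((gamma - l.1) * (beta / l.2)
         * Finv gamma (beta * gamma / l.2)
             ((log_lap w gamma l.2 (emp_gibbs w l.2))%:E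
              - log_weight nu eps beta gamma))%:E)%E
    | l in lambda_range beta gamma].

Definition coef (beta gamma l1 l2 : R) : R :=
  beta / l2 * ((1 - l1 / gamma)
    / (N%:R / gamma * tanh (gamma / N%:R) - beta / l2)).

Definition explicit_bound (nu : probability (measurableTypeR R) R) (eps : R)
    (w : sample) (rho : probability Theta R) (beta gamma : R) : \bar R :=
  ereal_inf [set (common_terms w rho gamma l.1 l.2
      + (coef beta gamma l.1 l.2 * log_lap w gamma l.2 (emp_gibbs w l.2))%:E
      - (1 + coef beta gamma l.1 l.2)%:E * log_weight nu eps beta gamma)%E
    | l in lambda_range beta gamma].

End learning.

(* Main.v *)
(* With t = tanh(gamma/N), the identity
     exp(- (gamma/N) chi - log(cosh(gamma/N)) |chi|) = 1 - t chi
   for chi in {-1, 0, 1}, independence and the arithmetic-geometric mean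
   inequality show that
     exp(- N log(1 - t (R(th) - R(th'))) - gamma (r(th) - r(th'))
         - N log(cosh(gamma/N)) m'(th, th'))
   has P-mean at most 1 for all th, th'.  Averaging over th, th' drawn from the
   Gibbs prior q = pi_exp(-beta R) and over the atoms of nu yields the event.
   There, the Donsker-Varadhan inequality for rho and the Gibbs variational
   principle for q bound F_(gamma, beta) of the risk gap by the empirical terms
   plus (gamma - lambda1) h, where h = pi_exp(-lambda2 r)(r) - q(r).

   It remains to remove h, which involves the unobservable q.  The same bound at
   rho = pi_exp(-lambda2 r), together with
   lambda2 h <= beta (pi_exp(-lambda2 r)(R) - q(R)), gives
   h <= beta/lambda2 F^-1(...) as long as F_(gamma, beta) is increasing on the
   relevant range.  This may fail when beta > N t and lambda2 > gamma; then going
   from q to pi_exp(-lambda1 r) through pi_exp(-lambda2 r) gives a second bound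
   in which (gamma - lambda1) h is replaced by log_lap(lambda2) -
   (lambda2 - gamma) h, and one of the two bounds always suffices. *)

Require Import Defs.
From mathcomp Require Import ring lra.

Import Order.TTheory GRing.Theory Num.Theory.
Import numFieldNormedType.Exports.

Set Implicit Arguments.
Unset Strict Implicit.
Unset Printing Implicit Defensive.

Local Open Scope classical_set_scope.
Local Open Scope ring_scope.

(** * Bounded measurable functions, Gibbs measures, relative entropy *)

Section bounded_measurable.
Context d (T : measurableType d) (R : realType).
Implicit Types (h k : T -> R) (p : probability T R).

(** A class stable under the operations used below and integrable against every probability measure,
    so that the usual rules of integration hold in it without further conditions. *)
Definition bmeas h :=
  measurable_fun [set: T] h /\ exists M : R, forall x, `|h x| <= M.

Lemma bmeas_cst (c : R) : bmeas (fun=> c).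
Proof. by split; [exact: measurable_cst|exists `|c|]. Qed.

Lemma bmeasD h k : bmeas h -> bmeas k -> bmeas (fun x => h x + k x).
Proof.
move=> [mh [M hM]] [mk [M' kM]]; split; first exact: measurable_funD.
by exists (M + M') => x; rewrite (le_trans (ler_normD _ _))// lerD.
Qed.

Lemma bmeasM h k : bmeas h -> bmeas k -> bmeas (fun x => h x * k x).
Proof.
move=> [mh [M hM]] [mk [M' kM]]; split; first exact: measurable_funM.
by exists (M * M') => x; rewrite normrM ler_pM.
Qed.

Lemma bmeasZ (c : R) h : bmeas h -> bmeas (fun x => c * h x).
Proof. exact/bmeasM/bmeas_cst. Qed.

Lemma bmeasN h : bmeas h -> bmeas (fun x => - h x).
Proof.
move=> /(bmeasZ (-1)); congr bmeas; apply/funext => x; exact: mulN1r.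
Qed.

Lemma bmeasB h k : bmeas h -> bmeas k -> bmeas (fun x => h x - k x).
Proof. by move=> bh bk; apply: bmeasD => //; exact: bmeasN. Qed.

Lemma bmeas_expR h : bmeas h -> bmeas (fun x => expR (h x)).
Proof.
move=> [mh [M hM]]; split; first exact: measurableT_comp.
exists (expR M) => x; rewrite ger0_norm ?expR_ge0// ler_expR.
exact: le_trans (ler_norm _) (hM x).
Qed.

Lemma bmeas_ln h (c : R) : bmeas h -> 0 < c -> (forall x, c <= h x) ->
  bmeas (fun x => ln (h x)).
Proof.
move=> [mh [M hM]] c0 ch; split; first exact: measurableT_comp.
have h0 x : 0 < h x := lt_le_trans c0 (ch x).
exists (`|ln c| + `|ln M|) => x.
have cM : h x <= M := le_trans (ler_norm _) (hM x).
have l1 : ln c <= ln (h x) by rewrite ler_ln ?posrE.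
have l2 : ln (h x) <= ln M by rewrite ler_ln ?posrE ?(lt_le_trans (h0 x)).
rewrite ler_norml; apply/andP; split.
  rewrite lerNl; have := ler_norm (- ln c); rewrite normrN.
  by have := normr_ge0 (ln M); lra.
by have := ler_norm (ln M); have := normr_ge0 (ln c); lra.
Qed.

Lemma bmeas_sum I (s : seq I) (h : I -> T -> R) : (forall i, bmeas (h i)) ->
  bmeas (fun x => \sum_(i <- s) h i x).
Proof.
move=> bh; elim: s => [|i s IHs].
  have -> : (fun x => \sum_(i <- [::]) h i x) = fun=> 0.
    by apply/funext => x; rewrite big_nil.
  exact: bmeas_cst.
have -> : (fun x => \sum_(j <- i :: s) h j x) =
    (fun x => h i x + \sum_(j <- s) h j x).
  by apply/funext => x; rewrite big_cons.
exact: bmeasD.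
Qed.

Lemma bmeas_prod I (s : seq I) (h : I -> T -> R) : (forall i, bmeas (h i)) ->
  bmeas (fun x => \prod_(i <- s) h i x).
Proof.
move=> bh; elim: s => [|i s IHs].
  have -> : (fun x => \prod_(i <- [::]) h i x) = fun=> 1.
    by apply/funext => x; rewrite big_nil.
  exact: bmeas_cst.
have -> : (fun x => \prod_(j <- i :: s) h j x) =
    (fun x => h i x * \prod_(j <- s) h j x).
  by apply/funext => x; rewrite big_cons.
exact: bmeasM.
Qed.

Lemma bmeas_norm h : bmeas h -> bmeas (fun x => `|h x|).
Proof.
move=> [mh [M hM]]; split; first exact: measurableT_comp.
by exists M => x; rewrite normr_id.
Qed.

Lemma bmeas_EFin h : bmeas h -> measurable_fun [set: T] (EFin \o h).
Proof. by move=> [mh _]; exact/measurable_EFinP. Qed.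

Lemma bmeas_integrable p h : bmeas h -> p.-integrable setT (EFin \o h).
Proof.
move=> [mh [M hM]]; apply: measurable_bounded_integrable => //=.
  by rewrite (le_lt_trans (probability_le1 _ _))// ltry.
by exists M; split; [exact: num_real|move=> x Mx y _; exact/(le_trans (hM y))/ltW].
Qed.

Lemma integral_bmeas p h : bmeas h ->
  (\int[p]_x (h x)%:E)%E = (\int[p]_x h x)%:E.
Proof.
move=> bh; rewrite /Rintegral fineK//.
by apply: integrable_fin_num => //; exact: bmeas_integrable.
Qed.

Lemma prob_Rintegral_cst p (c : R) : \int[p]_x c = c.
Proof. by rewrite Rintegral_cst//= probability_setT mulr1. Qed.

Lemma prob_RintegralD p h k : bmeas h -> bmeas k ->
  \int[p]_x (h x + k x) = \int[p]_x h x + \int[p]_x k x.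
Proof. by move=> bh bk; rewrite RintegralD//; exact: bmeas_integrable. Qed.

Lemma prob_RintegralZ p (c : R) h : bmeas h ->
  \int[p]_x (c * h x) = c * \int[p]_x h x.
Proof. by move=> bh; rewrite RintegralZl//; exact: bmeas_integrable. Qed.

Lemma prob_RintegralB p h k : bmeas h -> bmeas k ->
  \int[p]_x (h x - k x) = \int[p]_x h x - \int[p]_x k x.
Proof. by move=> bh bk; rewrite RintegralB//; exact: bmeas_integrable. Qed.

Lemma prob_le_Rintegral p h k : bmeas h -> bmeas k ->
  (forall x, h x <= k x) -> \int[p]_x h x <= \int[p]_x k x.
Proof. by move=> bh bk hk; apply: le_Rintegral => //; exact: bmeas_integrable. Qed.

Lemma prob_Rintegral_le p h (c : R) : bmeas h ->
  (forall x, h x <= c) -> \int[p]_x h x <= c.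
Proof.
move=> bh hc; rewrite -[leRHS](prob_Rintegral_cst p).
by apply: prob_le_Rintegral => //; exact: bmeas_cst.
Qed.

Lemma prob_Rintegral_ge p h (c : R) : bmeas h ->
  (forall x, c <= h x) -> c <= \int[p]_x h x.
Proof.
move=> bh hc; rewrite -[leLHS](prob_Rintegral_cst p).
by apply: prob_le_Rintegral => //; exact: bmeas_cst.
Qed.

Lemma Rintegral_expR_gt0 p h : bmeas h -> 0 < \int[p]_x expR (h x).
Proof.
move=> bh; have [mh [M hM]] := bh.
apply: (lt_le_trans (expR_gt0 (- M))).
apply: prob_Rintegral_ge; first exact: bmeas_expR.
by move=> x; rewrite ler_expR; move: (hM x); rewrite ler_norml => /andP[].
Qed.

(** The tangent to exp at the mean [m] lies below exp, and its composition with [h] has mean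
    [expR m]. *)
Lemma jensen_expR p h : bmeas h ->
  expR (\int[p]_x h x) <= \int[p]_x expR (h x).
Proof.
move=> bh; set m := \int[p]_x h x.
have -> : expR m = \int[p]_x (expR m * (1 - m + h x)).
  rewrite prob_RintegralZ; last by apply: bmeasD => //; exact: bmeas_cst.
  rewrite prob_RintegralD//; last exact: bmeas_cst.
  by rewrite prob_Rintegral_cst -/m; ring.
apply: prob_le_Rintegral => [| |x].
- by apply: bmeasZ; apply: bmeasD => //; exact: bmeas_cst.
- exact: bmeas_expR.
rewrite -[in leRHS](subrK m (h x)) expRD mulrC ler_wpM2r ?expR_ge0//.
by apply: le_trans (expR_ge1Dx _); lra.
Qed.

(** [jensen_expR] applied to [ln (h x)]; the uniform lower bound [c] keeps this function bounded. *)
Lemma jensen_ln p h (c : R) : bmeas h -> 0 < c -> (forall x, c <= h x) ->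
  \int[p]_x ln (h x) <= ln (\int[p]_x h x).
Proof.
move=> bh c0 ch; rewrite -ler_expR lnK; last first.
  by rewrite posrE (lt_le_trans c0)//; exact: prob_Rintegral_ge.
apply: (le_trans (jensen_expR p (bmeas_ln bh c0 ch))).
by under eq_Rintegral do rewrite lnK ?posrE ?(lt_le_trans c0)//.
Qed.

End bounded_measurable.

(** * Log-Laplace transforms and variational inequalities *)

Section log_laplace.
Context d (T : measurableType d) (R : realType).
Implicit Types (a b h : T -> R) (p q : probability T R).

Definition logmgf p h : R := ln (\int[p]_x expR (h x)).

Lemma logmgf_ge0 p h : bmeas h -> (forall x, 0 <= h x) -> 0 <= logmgf p h.
Proof.
move=> bh h0; rewrite ln_ge0//; apply: prob_Rintegral_ge.
  exact: bmeas_expR.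
by move=> x; rewrite -expR0 ler_expR.
Qed.

Lemma gibbs_dominates p a : bmeas a -> gibbs p a `<< p.
Proof.
move=> [ma ba]; apply/null_content_dominatesP => A mA pA0.
rewrite gibbsE//; apply: null_set_integral => //.
apply/measurable_funTS/measurable_EFinP; apply: measurable_funM => //.
exact: measurableT_comp.
Qed.

Lemma integral_gibbs p a (f : T -> \bar R) : bmeas a ->
  (forall x, (0 <= f x)%E) -> measurable_fun [set: T] f ->
  (\int[gibbs p a]_x f x =
   \int[p]_x (f x * (expR (a x) / \int[p]_y expR (a y))%:E))%E.
Proof.
move=> bm f0 mf; have [ma ba] := bm.
have domp : gibbs p a `<< p := gibbs_dominates bm.
rewrite -(@Radon_Nikodym_SigmaFinite.change_of_variables _ _ _ _ p)//.
have mRN : p.-integrable setT (Radon_Nikodym_SigmaFinite.f (gibbs p a) p).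
  exact: Radon_Nikodym_SigmaFinite.f_integrable.
have mdens : measurable_fun [set: T]
    (fun x => (expR (a x) / \int[p]_y expR (a y))%:E).
  apply/measurable_EFinP; apply: measurable_funM => //.
  exact: measurableT_comp.
apply: ae_eq_integral => //.
- by apply: emeasurable_funM => //; exact: measurable_int mRN.
- exact: emeasurable_funM.
(* The Radon-Nikodym derivative and the explicit Gibbs density have the same integral over every
   measurable set, hence agree almost everywhere. *)
- apply: ae_eqe_mul2l; apply: integral_ae_eq => // E _ mE.
  by rewrite -(Radon_Nikodym_SigmaFinite.f_integral domp mE); exact: gibbsE.
Qed.

(** Tilting by [a] and then by [h] is tilting by [a + h]; the subtracted term is the log normalising
    constant of the first tilt. *)
Lemma logmgf_gibbs p a h : bmeas a -> bmeas h ->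
  logmgf (gibbs p a) h = logmgf p (fun x => a x + h x) - logmgf p a.
Proof.
move=> ba bh.
have bah : bmeas (fun x => expR (a x + h x)) by exact/bmeas_expR/bmeasD.
rewrite /logmgf -ln_div ?posrE ?Rintegral_expR_gt0//; last exact: bmeasD.
congr ln; apply/EFin_inj.
rewrite -[LHS]integral_bmeas; last exact: bmeas_expR.
rewrite integral_gibbs//; last exact/bmeas_EFin/bmeas_expR.
rewrite mulrC -prob_RintegralZ//.
rewrite -integral_bmeas; last exact: bmeasZ.
by apply: eq_integral => x _; rewrite -EFinM expRD; congr EFin; ring.
Qed.

(** Jensen's inequality under [gibbs p a] for [b - a], whose log-Laplace transform there is the
    difference of the two log normalising constants. *)
Lemma gibbs_variational p a b : bmeas a -> bmeas b ->
  \int[gibbs p a]_x (b x - a x) <= logmgf p b - logmgf p a.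
Proof.
move=> ba bb; have bba : bmeas (fun x => b x - a x) by exact: bmeasB.
have -> : logmgf p b = logmgf p (fun x => a x + (b x - a x)).
  by congr logmgf; apply/funext => x; rewrite addrC subrK.
rewrite -logmgf_gibbs// -ler_expR lnK ?posrE ?Rintegral_expR_gt0//.
exact: jensen_expR.
Qed.

(* ln y >= 1 - 1/y at y = (dp/dq) e^(ln q(e^h) - h) bounds ln (dp/dq) below by
   an integrable function, so that the negative part of ln (dp/dq) is
   p-integrable. *)
Lemma donsker_varadhan p q h : bmeas h ->
  ((\int[p]_x h x)%:E <= KL p q + (logmgf q h)%:E)%E.
Proof.
move=> bh; rewrite /KL; case: asboolP => pq; last first.
  by rewrite addye// leey.
pose g := Radon_Nikodym_SigmaFinite.f p q.
pose g' x := fine (g x).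
have gE x : g x = (g' x)%:E.
  by rewrite fineK//; exact: Radon_Nikodym_SigmaFinite.f_fin_num.
have g0 x : 0 <= g' x.
  by rewrite -lee_fin -gE; exact: Radon_Nikodym_SigmaFinite.f_ge0.
have mg : measurable_fun setT g'.
  apply/measurable_EFinP; have -> : EFin \o g' = g by apply/funext => x /=; rewrite gE.
  exact/measurable_int/Radon_Nikodym_SigmaFinite.f_integrable.
set RN := Radon_Nikodym _ _.
have -> : (\int[p]_x (ln (fine (RN x)))%:E = \int[p]_x (ln (g' x))%:E)%E.
  have mRN : measurable_fun setT RN by exact/measurable_int/Radon_Nikodym_integrable.
  apply: ae_eq_integral => //.
  - apply/measurable_EFinP; apply: measurableT_comp => //.
    exact: measurableT_comp.
  - by apply/measurable_EFinP; apply: measurableT_comp.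
  - apply: (ae_eq_comp (fun y => (ln (fine y))%:E)).
    apply: (null_dominates_ae_eq measurableT pq).
    exact: ae_eq_sym (ae_eq_Radon_Nikodym_SigmaFinite pq measurableT).
set c := logmgf q h.
have mh : measurable_fun setT h by case: bh.
pose k x := expR (h x - c - ln (g' x)).
have k0 x : 0 <= k x by exact: expR_ge0.
have bhc : bmeas (fun x => expR (h x - c)).
  by apply: bmeas_expR; apply: bmeasB => //; exact: bmeas_cst.
have mk : measurable_fun setT k.
  apply: measurableT_comp => //; apply: measurable_funB.
    exact: measurable_funB.
  exact: measurableT_comp.
(* Since [k] is e^(h - c) / g where g > 0, the product k g is at most e^(h - c), which has [q]-mean
   1 by the choice of [c]. Where g = 0, [ln] takes the default value 0, but the factor g annihilates
   [k]. *)
have intk : (\int[p]_x (k x)%:E <= 1)%E.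
  rewrite -(Radon_Nikodym_SigmaFinite.change_of_variables pq)//; last first.
    exact/measurable_EFinP.
  have -> : 1%E = (\int[q]_x (expR (h x - c))%:E)%E.
    rewrite integral_bmeas//; congr EFin.
    under eq_Rintegral do rewrite expRD mulrC.
    rewrite prob_RintegralZ; last exact: bmeas_expR.
    by rewrite expRN lnK ?posrE ?Rintegral_expR_gt0// mulVf// gt_eqF// Rintegral_expR_gt0.
  apply: ge0_le_integral => //.
  - by move=> x _; rewrite mule_ge0 ?lee_fin// Radon_Nikodym_SigmaFinite.f_ge0.
  - apply: emeasurable_funM; first exact/measurable_EFinP.
    exact/measurable_int/Radon_Nikodym_SigmaFinite.f_integrable.
  - exact: bmeas_EFin.
  move=> x _; rewrite -/g gE -EFinM lee_fin /k.
  have [->|gx] := eqVneq (g' x) 0; first by rewrite mulr0 expR_ge0.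
  by rewrite expRD expRN lnK ?divfK// posrE lt_neqAle eq_sym gx g0.
have ik : p.-integrable setT (EFin \o k).
  apply/integrableP; split; first exact/measurable_EFinP.
  under eq_integral do rewrite /= ger0_norm//.
  by rewrite (le_lt_trans intk)// ltry.
pose u x := h x - c + 1 - k x.
have mu : measurable_fun setT u.
  apply: measurable_funB => //; apply: measurable_funD => //.
  exact: measurable_funB.
have bhc1 : bmeas (fun x => h x - c + 1).
  by apply: bmeasD; [apply: bmeasB => //|]; exact: bmeas_cst.
have intu : ((\int[p]_x h x - c)%:E <= \int[p]_x (u x)%:E)%E.
  rewrite /u integralB_EFin//; last exact: bmeas_integrable.
  rewrite integral_bmeas// prob_RintegralD; last 2 first.
  - by apply: bmeasB => //; exact: bmeas_cst.
  - exact: bmeas_cst.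
  rewrite prob_RintegralB//; last exact: bmeas_cst.
  rewrite !prob_Rintegral_cst.
  have fk : (\int[p]_x (k x)%:E)%E \is a fin_num by exact: integrable_fin_num.
  move: intk; rewrite /= -(fineK fk) lee_fin => intk.
  by rewrite -EFinB lee_fin; lra.
rewrite -leeBlDr// -EFinB (le_trans intu)//.
have mlng : measurable_fun setT (fun x => (ln (g' x))%:E).
  by apply/measurable_EFinP; apply: measurableT_comp.
have ug x : ((u x)%:E <= (ln (g' x))%:E)%E.
  by rewrite lee_fin /u /k; have := expR_ge1Dx (h x - c - ln (g' x)); lra.
(* The integral of ln g may be infinite, so positive and negative parts are compared separately. *)
rewrite integralE [leRHS]integralE leeB//.
- apply: ge0_le_integral => //.
  + exact/measurable_funepos/measurable_EFinP.
  + exact: measurable_funepos.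
  + by move=> x _; rewrite !funeposE ge_max !le_max ug lexx/= orbT.
- apply: ge0_le_integral => //.
  + exact: measurable_funeneg.
  + exact/measurable_funeneg/measurable_EFinP.
  + by move=> x _; rewrite !funenegE ge_max !le_max leeN2 ug lexx/= orbT.
Qed.

End log_laplace.

(** * The functions F and F^-1 *)

Section hyperbolic.
Context (R : realType).
Implicit Types x : R.

Lemma cosh_ge1 x : 1 <= cosh x.
Proof.
rewrite /cosh expRN; have e0 := expR_gt0 x.
rewrite ler_pdivlMr// mul1r -subr_ge0.
have -> : expR x + (expR x)^-1 - 2 = (expR x - 1) ^+ 2 / expR x.
  by field; rewrite gt_eqF.
by rewrite divr_ge0 ?sqr_ge0// ltW.
Qed.

Lemma tanh_gt0 x : 0 < x -> 0 < tanh x.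
Proof.
move=> x0; rewrite /tanh divr_gt0//; last by rewrite addr_gt0 ?expR_gt0.
by rewrite subr_gt0 ltr_expR; lra.
Qed.

Lemma normr_tanh_lt1 x : `|tanh x| < 1.
Proof.
have e1 := expR_gt0 x; have e2 := expR_gt0 (- x).
rewrite ltr_norml; apply/andP; split.
  by rewrite ltr_pdivlMr; [lra|exact: addr_gt0].
by rewrite ltr_pdivrMr; [lra|exact: addr_gt0].
Qed.

(** Division by [cosh x] normalises: e^(-x) / cosh x = 1 - tanh x and e^x / cosh x = 1 + tanh x.
    When the two bits agree, both sides are 1. *)
Lemma expR_tanh x (b b' : bool) :
  expR (- x * (b%:R - b'%:R) - ln (cosh x) * `|b%:R - b'%:R|) =
  1 - tanh x * (b%:R - b'%:R).
Proof.
have e1 := expR_gt0 x; have e2 := expR_gt0 (- x).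
have c0 : 0 < cosh x := lt_le_trans ltr01 (cosh_ge1 x).
have s0 : expR x + expR (- x) != 0 by rewrite gt_eqF// addr_gt0.
case: b; case: b' => /=; rewrite ?subrr ?subr0 ?sub0r ?normrN ?normr1 ?normr0.
- by rewrite !mulr0 subr0 expR0 subr0.
- rewrite !mulr1 expRD [X in _ * X = _]expRN lnK ?posrE// /tanh /cosh.
  by field; rewrite s0.
- rewrite (_ : - x * -1 - ln (cosh x) * 1 = x - ln (cosh x)); last by ring.
  rewrite expRD.
  rewrite [X in _ * X = _]expRN lnK ?posrE// /tanh /cosh.
  by field; rewrite s0.
- by rewrite !mulr0 subr0 expR0 subr0.
Qed.

End hyperbolic.

(** * Monotonicity and inversion of F, and the removal of the unobservable gap *)

Section F_gamma_alpha.
Context (R : realType) (N : nat).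
Hypothesis N_gt0 : (0 < N)%N.
Variable gamma : R.
Let n : R := N%:R.
Let t : R := tanh (gamma / n).
Implicit Types alpha beta x y : R.

Let n0 : 0 < n. Proof. by rewrite ltr0n. Qed.

(** Concavity: ln lies below its tangent at [x]. *)
Lemma ln_sub_le x y : 0 < x -> 0 < y -> ln y - ln x <= (y - x) / x.
Proof.
move=> x0 y0; rewrite -ln_div// mulrBl divff ?gt_eqF//.
have -> : ln (y / x) = ln (1 + (y / x - 1)) by congr ln; lra.
by apply: le_ln1Dx; have := divr_gt0 y0 x0; lra.
Qed.

Lemma FE alpha x : F N gamma alpha x = - (n * ln (1 - t * x)) - alpha * x.
Proof. by []. Qed.

(** The tangent bound ln (1 - u) <= - u at u = t x; [x] may be negative, as a risk gap may be. *)
Lemma F_ge alpha x : t * x < 1 -> (n * t - alpha) * x <= F N gamma alpha x.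
Proof.
move=> tx; rewrite FE.
have : ln (1 + - (t * x)) <= - (t * x) by apply: le_ln1Dx; lra.
by rewrite -(ler_pM2l n0) mulrN; lra.
Qed.

Hypothesis gamma0 : 0 < gamma.
Let t0 : 0 < t. Proof. by rewrite tanh_gt0// divr_gt0. Qed.
Let t1 : t < 1.
Proof. by move: (normr_tanh_lt1 (gamma / n)); rewrite ltr_norml => /andP[]. Qed.

(** For x >= 0 the derivative n t / (1 - t x) - alpha is at least n t - alpha > 0; the tangent bound
    on ln replaces differentiation. *)
Lemma F_lt alpha x y : alpha < n * t -> 0 <= x -> x < y -> t * y < 1 ->
  F N gamma alpha x < F N gamma alpha y.
Proof.
move=> an x0 xy ty1; rewrite !FE.
have txy : t * x < t * y by rewrite ltr_pM2l.
have u0 : 0 < 1 - t * x by lra.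
have v0 : 0 < 1 - t * y by lra.
have tx0 : 0 <= t * x by rewrite mulr_ge0// ltW.
have := ln_sub_le u0 v0.
have : (1 - t * y - (1 - t * x)) / (1 - t * x) <= - (t * (y - x)).
  rewrite ler_pdivrMr//; rewrite -subr_ge0.
  have -> : - (t * (y - x)) * (1 - t * x) - (1 - t * y - (1 - t * x)) =
    (t * y - t * x) * (t * x) by ring.
  by rewrite mulr_ge0//; lra.
move=> h1 h2; have : n * (ln (1 - t * y) - ln (1 - t * x)) <= - (n * t * (y - x)).
  rewrite (_ : - (n * t * (y - x)) = n * - (t * (y - x))); last by ring.
  by rewrite ler_pM2l//; exact: le_trans h2 h1.
have : alpha * (y - x) < n * t * (y - x) by rewrite ltr_pM2r//; lra.
by lra.
Qed.

(** [pinv] selects a preimage in [0, 1/t), whose existence comes from the intermediate value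
    theorem. *)
Lemma Finv_spec alpha y : alpha < n * t -> 0 <= y ->
  [/\ 0 <= Finv N gamma alpha y%:E, t * Finv N gamma alpha y%:E < 1 &
      F N gamma alpha (Finv N gamma alpha y%:E) = y].
Proof.
move=> an y0 /=; rewrite -/n -/t; set D := `[0, t^-1[%classic.
have DE x : D x -> 0 <= x /\ t * x < 1.
  rewrite /D /= in_itv/= => /andP[-> xt]; split=> //.
  by rewrite mulrC -ltr_pdivlMr// div1r.
have [x Dx Fx] : (F N gamma alpha @` D) y.
  (* The upper end [z] of the interval satisfies 1 - t z = e, so that F(z) = y + |alpha| / t - alpha
     z, which is at least [y] because 0 <= z <= 1/t. *)
  pose e : R := expR (- ((y + `|alpha| / t) / n)).
  have a0 : 0 <= `|alpha| / t by rewrite divr_ge0// ltW.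
  have e0 : 0 < e := expR_gt0 _.
  have e1 : e <= 1.
    by rewrite -expR0 ler_expR oppr_le0 divr_ge0 ?addr_ge0// ltW.
  pose z := (1 - e) / t.
  have z0 : 0 <= z by rewrite divr_ge0 ?(ltW t0)//; lra.
  have tz : t * z = 1 - e by rewrite /z mulrC divfK// gt_eqF.
  have zt : z < t^-1 by rewrite -(ltr_pM2l t0) tz divff ?gt_eqF//; lra.
  have Fz : y <= F N gamma alpha z.
    rewrite FE tz subKr expRK mulrN opprK mulrC divfK ?gt_eqF//.
    have : alpha * z <= `|alpha| / t.
      apply: le_trans (ler_norm _) _; rewrite normrM ler_wpM2l//.
      by rewrite ger0_norm// ltW.
    by lra.
  have F0 : F N gamma alpha 0 = 0 by rewrite FE !mulr0 !subr0 ln1 mulr0 oppr0.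
  have cF : {within `[0, z], continuous (F N gamma alpha)}.
    apply: continuous_in_subspaceT => x; rewrite inE/= in_itv/= => /andP[x0 xz].
    have tx : 0 < 1 - t * x.
      by rewrite subr_gt0 (le_lt_trans (y := t * z))// ?ler_pM2l//; lra.
    rewrite /F; apply: cvgB; last exact: cvgMl_tmp.
    apply: cvgN; apply: cvgMl_tmp; apply: continuous_comp; last exact: continuous_ln.
    by apply: cvgB; [exact: cvg_cst|exact: cvgMl_tmp].
  have [|x] := @IVT R (F N gamma alpha) 0 z y z0 cF.
    by rewrite F0 (min_idPl _) ?(max_idPr _) ?y0//; exact: le_trans Fz.
  rewrite in_itv/= => /andP[x0 xz] Fx; exists x => //.
  by rewrite /D /= in_itv/= x0 (le_lt_trans xz).
have im : y \in F N gamma alpha @` D by rewrite inE; exists x.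
have surj : set_surj D [set y] (F N gamma alpha) by move=> _ ->; exists x.
have /DE[z0 z1] : D ('pinv_(fun=> 0) D (F N gamma alpha) y).
  by apply: (surjpinv_image_sub (dflt := fun=> 0) surj); exists y.
by split=> //; exact: pinvK.
Qed.

(** [F_ge] at the preimage of [y]; this linear bound is what turns [bound] into [explicit_bound]. *)
Lemma Finv_le alpha y : alpha < n * t -> 0 <= y ->
  Finv N gamma alpha y%:E <= y / (n * t - alpha).
Proof.
move=> an y0; have [_ tx Fx] := Finv_spec an y0.
rewrite ler_pdivlMr; last by lra.
by rewrite mulrC -[leRHS]Fx; exact: F_ge.
Qed.

(** In the application [h] and [g] are the differences of empirical and of true mean risk between
    pi_exp(-lam2 r) and the Gibbs prior. Put x = lam2 h / beta, so that x <= g. If x <= y, the first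
    entry of the minimum is small enough. If y < x, then lam2 <= gamma is contradictory, and lam2 >
    gamma makes the second entry nonpositive. *)
Lemma gap_transfer beta lam1 lam2 (h g D L : R) (alpha := beta * gamma / lam2)
    (y := Finv N gamma alpha (L + D)%:E) :
  0 < beta -> 0 < lam2 -> lam1 <= gamma -> alpha < n * t -> t * g < 1 ->
  0 <= D -> 0 <= L ->
  F N gamma beta g <= (gamma - lam2) * h + L + D -> lam2 * h <= beta * g ->
  Num.min ((gamma - lam1) * h) (L - (lam2 - gamma) * h) <=
    (gamma - lam1) * (beta / lam2) * y.
Proof.
move=> beta0 lam20 lam1g an tg D0 L0 Fg hg.
have [y0 ty Fy] := Finv_spec an (addr_ge0 L0 D0); rewrite -/y in y0 ty Fy.
pose x := lam2 * h / beta.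
have betax : beta * x = lam2 * h by rewrite /x mulrC divfK// gt_eqF.
have hx : h = beta / lam2 * x.
  by rewrite mulrAC betax mulrC mulKf// gt_eqF.
have alphaE : alpha = gamma * (beta / lam2) by rewrite /alpha; ring.
have s0 : 0 < beta / lam2 by rewrite divr_gt0.
have lam2s : lam2 * (beta / lam2) = beta by rewrite mulrC divfK// gt_eqF.
have xg : x <= g by rewrite -(ler_pM2l beta0) betax.
rewrite ge_min; have [xy|yx] := leP x y.
  by rewrite {1}hx mulrA ler_wpM2l// mulr_ge0// ?subr_ge0// ltW.
have txg : t * x <= t * g by rewrite ler_pM2l.
have tx1 : t * x < 1 by lra.
have Fswap z : F N gamma alpha z = F N gamma beta z + (beta - alpha) * z.
  by rewrite !FE; ring.
have Fyx : L + D < F N gamma alpha x by rewrite -Fy; exact: F_lt.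
have [lg|gl] := leP lam2 gamma.
  (* here F_(gamma, alpha) g <= L + D = F_(gamma, alpha) y although y < g *)
  exfalso.
  have : L + D < F N gamma alpha g by rewrite -Fy; apply: F_lt => //; lra.
  rewrite Fswap; move: Fg; rewrite {1}hx.
  have : (gamma - lam2) * (beta / lam2) * x <= (gamma - lam2) * (beta / lam2) * g.
    by rewrite ler_wpM2l// mulr_ge0 ?subr_ge0// ltW.
  have -> : beta - alpha = - ((gamma - lam2) * (beta / lam2)).
    by rewrite mulrBl lam2s alphaE; ring.
  by lra.
have xs : (gamma - lam2) * h = - ((beta - alpha) * x).
  by rewrite hx mulrA mulrBl lam2s -alphaE; ring.
(* With [xs], the hypothesis reads F_beta(g) <= L + D - (beta - alpha) x, while L + D < F_alpha(x) =
   F_beta(x) + (beta - alpha) x. *)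
have Fgx : F N gamma beta g < F N gamma beta x.
  by move: Fyx; rewrite Fswap; move: Fg; rewrite xs; lra.
have xltg : x < g.
  by rewrite lt_neqAle xg andbT; apply: contraTneq Fgx => ->; rewrite ltxx.
(* F_(gamma, beta) decreases somewhere beyond y, hence F_(gamma, beta) y <= 0
   by convexity *)
have slope : n * t < beta * (1 - t * x).
  have u0 : 0 < 1 - t * g by lra.
  have v0 : 0 < 1 - t * x by lra.
  have := ln_sub_le v0 u0.
  have -> : 1 - t * g - (1 - t * x) = - (t * (g - x)) by ring.
  rewrite mulNr -(ler_pM2l n0) mulrN; move: Fgx; rewrite !FE => h1 h2.
  have : n * (t * (g - x) / (1 - t * x)) < beta * (g - x) by lra.
  rewrite (_ : n * (t * (g - x) / (1 - t * x)) = n * t / (1 - t * x) * (g - x)).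
    by rewrite ltr_pM2r ?subr_gt0// ltr_pdivrMr.
  by ring.
have Fby : F N gamma beta y <= 0.
  have u0 : 0 < 1 - t * y by lra.
  have := @ln_sub_le (1 - t * y) 1 u0 ltr01; rewrite ln1 sub0r.
  have -> : 1 - (1 - t * y) = t * y by ring.
  rewrite -(ler_pM2l n0) mulrN => lny.
  have nt : n * t <= beta * (1 - t * y).
    have tyx : t * y < t * x by rewrite ltr_pM2l.
    by apply: (le_trans (ltW slope)); rewrite ler_pM2l//; lra.
  have : n * (t * y / (1 - t * y)) <= beta * y.
    rewrite (_ : n * (t * y / (1 - t * y)) = n * t / (1 - t * y) * y).
      by rewrite ler_wpM2r// ler_pdivrMr.
    by ring.
  by rewrite FE; lra.
(* L + D = F_alpha(y) = F_beta(y) + (beta - alpha) y <= (beta - alpha) x = (lam2 - gamma) h. *)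
apply/orP; right; have : L - (lam2 - gamma) * h <= 0.
  have ba : alpha <= beta by rewrite -subr_ge0 alphaE -[X in X - _]lam2s -mulrBl mulr_ge0 ?subr_ge0 ?(ltW s0) ?ltW.
  have : (beta - alpha) * y <= (beta - alpha) * x.
    by rewrite ler_wpM2l ?subr_ge0// ltW.
  by move: Fy; rewrite Fswap; move: xs; lra.
move=> /le_trans; apply; rewrite mulr_ge0//.
by rewrite mulr_ge0 ?subr_ge0// ltW.
Qed.

End F_gamma_alpha.

(** * Simultaneity over the atoms of nu *)

Section union_over_atoms.
Context d (T : measurableType d) (R : realType) (P : probability T R).
Variables (nu : probability (measurableTypeR R) R).
Local Open Scope ereal_scope.

Lemma prob_markov (Z : T -> \bar R) (e : R) : (0 < e)%R ->
  measurable_fun [set: T] Z -> (forall w, 0 <= Z w) -> \int[P]_w Z w <= 1 ->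
  exists A : set T, [/\ measurable A, (1 - e)%:E <= P A &
    forall w, A w -> Z w <= (e^-1)%:E].
Proof.
move=> e0 mZ Z0 Z1; pose B := [set w | (e^-1)%:E < Z w].
have mB : measurable B.
  by rewrite -[B]setTI; exact: emeasurable_fun_o_infty.
have PB : P B <= e%:E.
  have : (e^-1)%:E * P B <= 1.
    apply: (le_trans _ Z1).
    rewrite -(setIT B) -integral_indic// -ge0_integralZl//.
    - apply: ge0_le_integral => //.
      + by move=> w _; rewrite mule_ge0// lee_fin// invr_ge0 ltW.
      + by apply/measurable_EFinP; apply: measurable_funM.
      + move=> w _; rewrite indicE; case: (boolP (w \in B)) => wB /=.
          by rewrite mule1; move: wB; rewrite inE => /ltW.
        by rewrite mule0.
    - exact/measurable_EFinP.
    - by rewrite lee_fin invr_ge0 ltW.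
  rewrite -(fineK (fin_num_measure P B mB)) -EFinM !lee_fin.
  by rewrite mulrC ler_pdivrMr// mul1r.
exists (~` B); split; first exact: measurableC.
  by rewrite probability_setC// EFinB leeB.
by move=> w /negP; rewrite -leNgt.
Qed.

(* Averaging W b g over nu \x nu gives a single nonnegative variable of mean at
   most 1, so that one Markov inequality replaces the union bound. *)
Lemma uniform_over_atoms (W : R -> R -> T -> \bar R) (e : R) :
  atomic nu -> (0 < e)%R ->
  (forall b g, measurable_fun [set: T] (W b g)) ->
  (forall b g w, 0 <= W b g w) -> (forall b g, \int[P]_w W b g w <= 1) ->
  exists A : set T, [/\ measurable A, (1 - e)%:E <= P A &
    forall w b g, A w -> 0 < nu [set b] -> 0 < nu [set g] ->
      nu [set b] * nu [set g] * W b g w <= (e^-1)%:E].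
Proof.
move=> [A0 [cA0 nuA0]] e0 mW W0 W1.
have mA0 : measurable (A0 : set (measurableTypeR R)).
  exact: countable_measurable.
have [phi phi_inj] := countable_injP _ cA0.
(* The injection [phi] enumerates the atoms: the fibre [B n] is empty or a singleton, and [r n] is
   its point. On an empty fibre [r n] defaults to 0, harmlessly since its weight nu (B n) is then
   0. *)
pose B n : set (measurableTypeR R) := A0 `&` [set x | phi x = n].
have cB n : countable (B n) by apply: (sub_countable _ cA0); apply: subset_card_le => x [].
have mB n : measurable (B n) by exact: countable_measurable.
pose r n : R := xget 0%R (B n).
have sumB : \sum_(n <oo) nu (B n) <= 1.
  rewrite -measure_semi_bigcup//.
  - exact: probability_le1 (bigcupT_measurable _ mB).
  - by move=> i j _ _ [x [[_ /= <-] [_ /= <-]]].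
  - exact: bigcupT_measurable.
(* A point of positive mass must belong to [A0], which already carries the total mass 1. *)
have BE b : 0 < nu [set b] -> B (phi b) = [set b].
  move=> nub; have A0b : A0 b.
    apply: contrapT => A0b; have : nu (A0 `|` [set b]) <= 1.
      by apply: probability_le1; exact: measurableU.
    rewrite measureU//; last first.
      by apply/seteqP; split=> // x [/= A0x xb]; apply: A0b; rewrite -xb.
    move=> h; have : nu A0 + nu [set b] <= 1 := h.
    by apply/negP; rewrite nuA0 -ltNge lteDl.
  apply/seteqP; split=> [x [A0x /= xb]|x ->//].
  by apply: phi_inj; rewrite ?inE.
pose Z w := \sum_(n <oo) nu (B n) * \sum_(m <oo) nu (B m) * W (r n) (r m) w.
have mZ1 n : measurable_fun setT
    (fun w => \sum_(m <oo) nu (B m) * W (r n) (r m) w).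
  apply: ge0_emeasurable_sum => [m w _ _|m _]; first exact: mule_ge0.
  by apply: emeasurable_funM.
have mZ : measurable_fun setT Z.
  apply: ge0_emeasurable_sum => [n w _ _|n _].
    by rewrite mule_ge0// nneseries_ge0// => m _ _; exact: mule_ge0.
  exact: emeasurable_funM.
have Z0 w : 0 <= Z w.
  apply: nneseries_ge0 => n _ _; rewrite mule_ge0//.
  by apply: nneseries_ge0 => m _ _; exact: mule_ge0.
have Z1 : \int[P]_w Z w <= 1.
  rewrite integral_nneseries//; last 2 first.
  - by move=> n; exact: emeasurable_funM.
  - move=> n w _; rewrite mule_ge0// nneseries_ge0// => m _ _.
    exact: mule_ge0.
  apply: (le_trans _ sumB); apply: lee_nneseries => [n _ _|n _].
    apply: integral_ge0 => w _; rewrite mule_ge0// nneseries_ge0// => m _ _.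
    exact: mule_ge0.
  rewrite ge0_integralZl//; last first.
    by move=> w _; apply: nneseries_ge0 => m _ _; exact: mule_ge0.
  rewrite -[leRHS]mule1 lee_wpmul2l// integral_nneseries//; last 2 first.
  - by move=> m; exact: emeasurable_funM.
  - by move=> m w _; exact: mule_ge0.
  apply: (le_trans _ sumB); apply: lee_nneseries => [m _ _|m _].
    by apply: integral_ge0 => w _; exact: mule_ge0.
  by rewrite ge0_integralZl// -[leRHS]mule1 lee_wpmul2l.
have [A [mA PA AZ]] := prob_markov e0 mZ Z0 Z1.
exists A; split=> // w b g Aw nub nug; apply: le_trans (AZ w Aw).
have rE c : 0 < nu [set c] -> r (phi c) = c.
  by move=> /BE Bc; apply: xget_unique; rewrite Bc.
have term_le (u : nat -> \bar R) k : (forall n, 0 <= u n) ->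
    u k <= \sum_(n <oo) u n.
  move=> u0; rewrite (nneseriesD1 (n := k))//.
  by apply: lee_paddr => //; exact: nneseries_ge0.
(* The pair (b, g) is recovered as the term of index ([phi b], [phi g]) of the nonnegative double
   series [Z w]. *)
apply: (@le_trans _ _ (nu (B (phi b)) *
    \sum_(m <oo) nu (B m) * W (r (phi b)) (r m) w)).
  rewrite BE// rE// -muleA lee_wpmul2l//.
  apply: (@le_trans _ _ (nu (B (phi g)) * W b (r (phi g)) w)).
    by rewrite BE// rE.
  apply: (term_le (fun m => nu (B m) * W b (r m) w)) => m.
  exact: mule_ge0.
apply: (term_le (fun n => nu (B n) *
  \sum_(m <oo) nu (B m) * W (r n) (r m) w)) => n.
by rewrite mule_ge0// nneseries_ge0// => m _ _; exact: mule_ge0.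
Qed.

End union_over_atoms.

(** * Product measures *)

Section parameter_integral.
Context d d' (S : measurableType d) (T : measurableType d') (R : realType).

Lemma bmeas_comp (h : T -> R) (u : S -> T) : bmeas h ->
  measurable_fun [set: S] u -> bmeas (h \o u).
Proof.
move=> [mh [M hM]] mu; split; first exact: measurableT_comp.
by exists M => x; exact: hM.
Qed.

Lemma bmeas_Rintegral (p : probability T R) (h : S * T -> R) : bmeas h ->
  (forall x, 0 <= h x) -> bmeas (fun s => \int[p]_t h (s, t)).
Proof.
move=> bh h0; have [mh [M hM]] := bh.
have bhs s : bmeas (fun t => h (s, t)).
  split; last by exists M => t; exact: hM.
  exact: measurable_fun_pair2.
split; last first.
  exists M => s; rewrite ger0_norm; last exact: Rintegral_ge0.
  by apply: prob_Rintegral_le => // t; exact: le_trans (ler_norm _) (hM _).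
apply: measurableT_comp => //=.
apply: (@measurable_fun_fubini_tonelli_F _ _ _ _ _ p (EFin \o h)) => //.
exact/measurable_EFinP.
Qed.

End parameter_integral.

Section fubini_bounded.
Context d d' (S : measurableType d) (T : measurableType d') (R : realType).

Lemma fubini_bmeas (p : probability S R) (q : probability T R)
    (h : S * T -> R) : bmeas h -> (forall x, 0 <= h x) ->
  \int[p]_s \int[q]_t h (s, t) = \int[q]_t \int[p]_s h (s, t).
Proof.
move=> bh h0; have [mh [M hM]] := bh; apply: EFin_inj.
have bh' : bmeas (fun x : T * S => h (x.2, x.1)).
  by apply: (bmeas_comp (u := fun x : T * S => (x.2, x.1)) bh); exact: measurable_fun_pair.
have bh1 s : bmeas (fun t => h (s, t)).
  by split; [exact: measurable_fun_pair2|exists M => t; exact: hM].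
have bh2 t : bmeas (fun s => h (s, t)).
  by split; [exact: measurable_fun_pair1|exists M => s; exact: hM].
rewrite -!integral_bmeas; last 2 first.
- by apply: (bmeas_Rintegral p bh') => x; exact: h0.
- exact: (bmeas_Rintegral q bh h0).
under eq_integral => s _.
  rewrite -integral_bmeas//; over.
under [RHS]eq_integral => t _.
  rewrite -integral_bmeas//; over.
apply: (@fubini_tonelli _ _ _ _ _ p q (EFin \o h)).
- exact/measurable_EFinP.
- by move=> x; rewrite lee_fin.
Qed.

End fubini_bounded.

(** * Independence for products of simple functions *)

Section product_moment.
Context d (T : measurableType d) (R : realType) (N : nat).
Variables (Pi : 'I_N -> probability T R) (P : probability (N.-tuple T) R).
Hypothesis P_product : is_product_measure Pi P.

Let measurable_rect (A : 'I_N -> set T) : (forall i, measurable (A i)) ->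
  measurable [set w : N.-tuple T | forall i, A i (tnth w i)].
Proof.
move=> mA; have -> : [set w : N.-tuple T | forall i, A i (tnth w i)] =
    \bigcap_(i in [set: 'I_N]) ((@tnth N T)^~ i @^-1` A i).
  by apply/seteqP; split=> w /= Aw i; [move=> _; exact: Aw|exact: (Aw i I)].
apply: fin_bigcap_measurable; first exact: finite_finset.
by move=> i _; rewrite -[X in measurable X]setTI; exact: measurable_tnth.
Qed.

(** The rectangle whose sides are all full except the [i]-th. *)
Lemma product_marginal (i : 'I_N) (B : set T) : measurable B ->
  P [set w | B (tnth w i)] = Pi i B.
Proof.
move=> mB; pose A j := if j == i then B else setT.
have mA j : measurable (A j) by rewrite /A; case: ifP.
have -> : [set w | B (tnth w i)] = [set w | forall j, A j (tnth w j)].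
  apply/seteqP; split=> w /= Bw; last by move: (Bw i); rewrite /A eqxx.
  by move=> j; rewrite /A; case: eqP => [->|].
rewrite P_product// (bigD1 i)//= big1 ?mule1 /A ?eqxx// => j /negbTE ->.
exact: probability_setT.
Qed.

(** Expanding both products over the choice functions [g] leaves sums over measurable rectangles, to
    which the defining formula of the product measure applies term by term. *)
Lemma product_moment (K : finType) (c : K -> R) (A : K -> set T) :
  (forall k, measurable (A k)) ->
  \int[P]_w \prod_(i < N) \sum_k c k * \1_(A k) (tnth w i) =
  \prod_(i < N) \sum_k c k * fine (Pi i (A k)).
Proof.
move=> mA; rewrite bigA_distr_bigA/=.
under eq_Rintegral do rewrite bigA_distr_bigA/=.
pose rect (g : {ffun 'I_N -> K}) :=
  [set w : N.-tuple T | forall i, A (g i) (tnth w i)].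
have mrect g : measurable (rect g).
  by apply: (measurable_rect (A := fun i => A (g i))) => i; exact: mA.
have brect g : bmeas (\1_(rect g) : _ -> R).
  split; first exact: (@measurable_indic _ _ R setT _ (mrect g)).
  by exists 1 => w; rewrite indicE; case: (_ \in _); rewrite ?normr1 ?normr0.
have prodE (g : {ffun 'I_N -> K}) (w : N.-tuple T) : \prod_i (c (g i) * \1_(A (g i)) (tnth w i)) =
    (\prod_i c (g i)) * \1_(rect g) w.
  rewrite big_split/=; congr (_ * _); rewrite indicE.
  have [wg|wg] := boolP (w \in rect g).
    by rewrite big1// => i _; rewrite indicE mem_set//; move: wg; rewrite inE.
  have [i wi] : exists i, ~ A (g i) (tnth w i).
    by apply: contrapT => /forallNP wA; move/negP: wg; apply; rewrite inE => i;
      exact: contrapT (wA i).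
  by rewrite (bigD1 i)//= indicE memNset// mul0r.
under eq_Rintegral do under eq_bigr do rewrite prodE.
have RsumE (s : seq {ffun 'I_N -> K}) :
    \int[P]_w (\sum_(g <- s) (\prod_i c (g i)) * \1_(rect g) w) =
    \sum_(g <- s) (\prod_i c (g i)) * fine (P (rect g)).
  elim: s => [|g s IHs].
    by rewrite big_nil; under eq_Rintegral do rewrite big_nil; exact: prob_Rintegral_cst.
  rewrite big_cons -IHs; under eq_Rintegral do rewrite big_cons.
  rewrite prob_RintegralD; last 2 first.
  - exact: bmeasZ.
  - by apply: bmeas_sum => g'; exact: bmeasZ.
  by rewrite prob_RintegralZ// /Rintegral integral_indic// setIT.
rewrite RsumE; apply: eq_bigr => g _.
rewrite big_split/=; congr (_ * _).
have -> := P_product (A := fun i => A (g i)) (fun i => mA (g i)).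
have -> : (\prod_(i < N) Pi i (A (g i)) =
    (\prod_(i < N) fine (Pi i (A (g i))))%:E)%E; last by [].
rewrite (big_morph EFin (@EFinM R) erefl); apply: eq_bigr => i _.
by rewrite fineK// fin_num_measure.
Qed.

End product_moment.

(** * The likelihood ratio of two classification rules *)

Section classification.
Context (R : realType) (N : nat) (dX dY dT : measure_display).
Context (X : measurableType dX) (Y : measurableType dY).
Context (Theta : measurableType dT).
Variables (P : probability (sample N X Y) R) (f : Theta -> X -> Y).
Hypothesis N_gt0 : (0 < N)%N.
Hypothesis Y_finite : finite_set [set: Y].
Hypothesis Y_discrete : forall A : set Y, measurable A.
Hypothesis f_measurable :
  measurable_fun [set: (Theta * X)%type] (fun p => f p.1 p.2).

Let n : R := N%:R.
Let n0 : 0 < n. Proof. by rewrite ltr0n. Qed.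

(** The complement is the finite union over the labels y of the sets where prediction and label both
    equal y. *)
Lemma measurable_misclassified :
  measurable [set p : Theta * (X * Y) | f p.1 p.2.1 != p.2.2].
Proof.
have mfx : measurable_fun [set: Theta * (X * Y)] (fun p => f p.1 p.2.1).
  rewrite -[fun _ => _]/((fun p => f p.1 p.2) \o
    (fun p : Theta * (X * Y) => (p.1, p.2.1))).
  apply: (measurableT_comp f_measurable).
  by apply: measurable_fun_pair => //; exact: measurableT_comp.
have my : measurable_fun [set: Theta * (X * Y)] (fun p => p.2.2).
  exact: measurableT_comp.
have -> : [set p : Theta * (X * Y) | f p.1 p.2.1 != p.2.2] =
    ~` \bigcup_(y in [set: Y]) ([set p | f p.1 p.2.1 = y] `&`
                                [set p | p.2.2 = y]).
  apply/seteqP; split=> [p /eqP/= fp [y _ [/= fy py]]|p /= fp].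
    by apply: fp; rewrite fy py.
  by apply/eqP => fy; apply: fp; exists p.2.2.
apply: measurableC; apply: fin_bigcup_measurable => // y _.
apply: measurableI; rewrite -[X in measurable X]setTI.
- exact: (mfx measurableT [set y] (Y_discrete _)).
- exact: (my measurableT [set y] (Y_discrete _)).
Qed.

Let measurable_section th :
  measurable [set z : X * Y | f th z.1 != z.2].
Proof.
have -> : [set z : X * Y | f th z.1 != z.2] =
    xsection [set p : Theta * (X * Y) | f p.1 p.2.1 != p.2.2] th.
  by apply/seteqP; split => z; rewrite /xsection /= inE.
by apply: measurable_xsection; exact: measurable_misclassified.
Qed.

Lemma err01 (w : sample N X Y) th (i : 'I_N) :
  0 <= err R f w th i <= 1.
Proof. by rewrite /err; case: (_ != _); rewrite ?lexx ?ler01. Qed.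

Section measurability_along.
Context d (S : measurableType d) (u u' : S -> Theta) (v : S -> sample N X Y).
Hypotheses (mu : measurable_fun [set: S] u) (mu' : measurable_fun [set: S] u').
Hypothesis mv : measurable_fun [set: S] v.

(** Stated along arbitrary measurable maps [u] and [v], so that measurability in the parameter, in
    the sample and jointly are all instances. *)
Lemma bmeas_err i : bmeas (fun s => err R f (v s) (u s) i).
Proof.
split; last first.
  exists 1 => s; have /andP[e0 e1] := err01 (v s) (u s) i.
  by rewrite ger0_norm.
have -> : (fun s => err R f (v s) (u s) i) =
    \1_[set p : Theta * (X * Y) | f p.1 p.2.1 != p.2.2] \o
    (fun s => (u s, tnth (v s) i)) :> (S -> R).
  apply/funext => s /=; rewrite /err indicE; congr ((nat_of_bool _)%:R).
  by apply/idP/idP; rewrite inE.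
apply: measurableT_comp.
  by apply: measurable_indic; exact: measurable_misclassified.
apply: measurable_fun_pair => //.
exact: (measurableT_comp (measurable_tnth i) mv).
Qed.

Lemma bmeas_emp_risk : bmeas (fun s => emp_risk R f (v s) (u s)).
Proof. by apply: bmeasZ; apply: bmeas_sum => i; exact: bmeas_err. Qed.

End measurability_along.

Lemma bmeas_emp_dist d (S : measurableType d) (u u' : S -> Theta)
    (v : S -> sample N X Y) : measurable_fun [set: S] u ->
  measurable_fun [set: S] u' -> measurable_fun [set: S] v ->
  bmeas (fun s => emp_dist R f (v s) (u s) (u' s)).
Proof.
move=> mu mu' mv; apply: bmeasZ; apply: bmeas_sum => i.
by apply: bmeas_norm; apply: bmeasB; exact: bmeas_err.
Qed.

Let measurable_error th i :
  measurable [set w : sample N X Y | f th (tnth w i).1 != (tnth w i).2].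
Proof.
rewrite -[X in measurable X]setTI.
exact: (measurable_tnth i measurableT (measurable_section th)).
Qed.

Let risk_i th i : R := fine (P [set w | f th (tnth w i).1 != (tnth w i).2]).

Let bmeas_err_sample th i : bmeas (fun w : sample N X Y => err R f w th i).
Proof. by apply: (@bmeas_err _ _ (fun=> th) id). Qed.

Let risk_iE th i : risk_i th i = \int[P]_w err R f w th i.
Proof.
rewrite /risk_i; set B := [set w | _].
have mB : measurable B by exact: measurable_error.
rewrite -(setIT B) -(integral_indic _ measurableT mB) /Rintegral.
congr fine; apply: eq_integral => w _; rewrite indicE /err.
by congr (_ %:R)%:E; congr nat_of_bool; apply/idP/idP; rewrite inE.
Qed.

(** Each error probability is the integral over the sample of a jointly measurable indicator, hence
    measurable in the parameter. *)
Lemma bmeas_risk : bmeas (risk f P).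
Proof.
apply: bmeasZ; apply: bmeas_sum => i.
have -> : (fun th => fine (P [set w | f th (tnth w i).1 != (tnth w i).2])) =
    (fun th => \int[P]_w err R f w th i).
  by apply/funext => th; exact: risk_iE.
apply: (bmeas_Rintegral P (h := fun x => err R f x.2 x.1 i)).
  exact: bmeas_err.
by move=> x; have /andP[] := err01 x.2 x.1 i.
Qed.

Let risk_i01 th i : 0 <= risk_i th i <= 1.
Proof.
rewrite /risk_i fine_ge0//= -lee_fin fineK ?fin_num_measure//.
exact: probability_le1 (measurable_error _ _).
Qed.

Lemma risk01 th : 0 <= risk f P th <= 1.
Proof.
apply/andP; split.
  rewrite mulr_ge0 ?invr_ge0 ?(ltW n0)// sumr_ge0// => i _.
  by have /andP[] := risk_i01 th i.
rewrite /risk mulrC ler_pdivrMr// mul1r.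
have -> : N%:R = \sum_(i < N) (1 : R) by rewrite sumr_const card_ord.
by apply: ler_sum => i _; have /andP[] := risk_i01 th i.
Qed.

(** * The ratio itself and its mean under the sample law *)

Section likelihood_ratio.
Variable t : R.
Hypothesis t1 : `|t| < 1.

Lemma t_gap_lt x y : 0 <= x <= 1 -> 0 <= y <= 1 -> t * (x - y) <= `|t|.
Proof.
move=> /andP[x0 x1] /andP[y0 y1]; apply: (le_trans (ler_norm _)).
by rewrite normrM ler_piMr// ler_norml; apply/andP; split; lra.
Qed.

(** At t = tanh(gamma/N) this is an exponential, see [lrE]; the product form is the one that
    independence can use. *)
Definition lr (w : sample N X Y) (z : Theta * Theta) : R :=
  (\prod_(i < N) (1 - t * (err R f w z.1 i - err R f w z.2 i))) *
  expR (- (n * ln (1 - t * (risk f P z.1 - risk f P z.2)))).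

Lemma lr_ge0 w z : 0 <= lr w z.
Proof.
rewrite mulr_ge0 ?expR_ge0// prodr_ge0// => i _.
have := t_gap_lt (err01 w z.1 i) (err01 w z.2 i).
by move: t1; rewrite subr_ge0; lra.
Qed.

Lemma bmeas_lr : bmeas (fun x : sample N X Y * (Theta * Theta) => lr x.1 x.2).
Proof.
have m1 : measurable_fun setT (fun x : sample N X Y * (Theta * Theta) => x.2.1).
  exact: measurableT_comp.
have m2 : measurable_fun setT (fun x : sample N X Y * (Theta * Theta) => x.2.2).
  exact: measurableT_comp.
apply: bmeasM.
  apply: bmeas_prod => i; apply: bmeasB; first exact: bmeas_cst.
  by apply: bmeasZ; apply: bmeasB; apply: bmeas_err.
apply: bmeas_expR; apply: bmeasN; apply: bmeasZ.
apply: (@bmeas_ln _ _ _ _ (1 - `|t|)).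
- apply: bmeasB; first exact: bmeas_cst.
  apply: bmeasZ; apply: bmeasB.
    exact: (bmeas_comp bmeas_risk m1).
  exact: (bmeas_comp bmeas_risk m2).
- by rewrite subr_gt0.
- by move=> x; rewrite lerD2l lerN2 t_gap_lt// risk01.
Qed.

Lemma bmeas_lrl z : bmeas (fun w => lr w z).
Proof.
have [m [M hM]] := bmeas_lr; split; last by exists M => w; exact: (hM (w, z)).
exact: (measurable_fun_pair1 z m).
Qed.

Lemma bmeas_lrr w : bmeas (lr w).
Proof.
have [m [M hM]] := bmeas_lr; split; last by exists M => z; exact: (hM (w, z)).
exact: (measurable_fun_pair2 w m).
Qed.

Variable Pi : 'I_N -> probability (X * Y)%type R.
Hypothesis P_product : is_product_measure Pi P.

(** Independence factorises the mean of the product, and the arithmetic-geometric mean inequality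
    bounds the result by the [N]-th power of the averaged factor [D], which the second factor of
    [lr] cancels. *)
Lemma lr_moment z : \int[P]_w lr w z <= 1.
Proof.
have bprod : bmeas (fun w : sample N X Y =>
    \prod_(i < N) (1 - t * (err R f w z.1 i - err R f w z.2 i))).
  apply: bmeas_prod => i; apply: bmeasB; first exact: bmeas_cst.
  by apply: bmeasZ; exact: bmeasB.
rewrite /lr; under eq_Rintegral do rewrite mulrC.
rewrite prob_RintegralZ//.
(* Each factor is a simple function on three sets: coefficient 1 on the whole space, - t and t on
   the error sets of [z.1] and [z.2]. *)
pose c (k : 'I_3) : R := if val k is 0%N then 1 else if val k is 1%N then - t else t.
pose B th := [set x : X * Y | f th x.1 != x.2].
pose A (k : 'I_3) : set (X * Y) :=
  if val k is 0%N then setT else if val k is 1%N then B z.1 else B z.2.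
have mA k : measurable (A k).
  by case: k => -[|[|[|m]]] // lt3; rewrite /A //=; exact: measurable_section.
have -> : \int[P]_w \prod_(i < N) (1 - t * (err R f w z.1 i - err R f w z.2 i)) =
    \int[P]_w \prod_(i < N) \sum_k c k * \1_(A k) (tnth w i).
  apply: eq_Rintegral => w _; apply: eq_bigr => i _.
  have indB th x : \1_(B th) x = (f th x.1 != x.2)%:R :> R.
    by rewrite indicE; congr (_ %:R); congr nat_of_bool; apply/idP/idP; rewrite inE.
  rewrite !big_ord_recl big_ord0 /c /A /= !indB indicT /err /=.
  by ring.
rewrite (product_moment P_product c mA).
have PiE i th : fine (Pi i (B th)) = risk_i th i.
  rewrite -(product_marginal P_product i (measurable_section th)) /risk_i.
  by [].
have -> : \prod_(i < N) \sum_k c k * fine (Pi i (A k)) =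
    \prod_(i < N) (1 - t * (risk_i z.1 i - risk_i z.2 i)).
  apply: eq_bigr => i _; rewrite !big_ord_recl big_ord0 /c /A /= !PiE.
  by rewrite probability_setT /=; ring.
set D := 1 - t * _.
have D0 : 0 < D.
  have := t_gap_lt (risk01 z.1) (risk01 z.2).
  by move: t1; rewrite /D; lra.
have agm : \prod_(i < N) (1 - t * (risk_i z.1 i - risk_i z.2 i)) <= D ^+ N.
  have pos i : i \in 'I_N -> 0 <= 1 - t * (risk_i z.1 i - risk_i z.2 i).
    by move=> _; have := t_gap_lt (risk_i01 z.1 i) (risk_i01 z.2 i); move: t1; lra.
  have := (leif_AGM pos).1; rewrite card_ord.
  congr (_ <= _ ^+ _).
  rewrite sumrB sumr_const card_ord -mulr_sumr sumrB /D /risk -/n.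
  rewrite -(mulrBr n^-1).
  by field; rewrite gt_eqF.
have -> : expR (- (n * ln D)) = (D ^+ N)^-1.
  by rewrite expRN mulrC expRM_natr lnK.
by rewrite mulrC ler_pdivrMr ?mul1r// exprn_gt0.
Qed.

(** Tonelli's theorem: the bound of [lr_moment] is uniform in the pair, so it survives averaging
    under a law [q] that does not depend on the sample. *)
Lemma lr_mean (q : probability (Theta * Theta)%type R) :
  (\int[P]_w \int[q]_z (lr w z)%:E <= 1)%E.
Proof.
have [m _] := bmeas_lr.
rewrite (fubini_tonelli (m1 := P) (m2 := q) (fun x => (lr x.1 x.2)%:E))//=.
- have -> : 1%E = (\int[q]_z 1%:E)%E :> \bar R.
    by rewrite integral_cst//= probability_setT mule1.
  apply: ge0_le_integral => //=.
  + by move=> z _; apply: integral_ge0 => w _; rewrite lee_fin lr_ge0.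
  + apply: (measurable_fun_fubini_tonelli_G (m1 := P)
      (fun x => (lr x.1 x.2)%:E)) => //=.
    * exact/measurable_EFinP.
    * by move=> x; rewrite lee_fin lr_ge0.
  + move=> z _; rewrite integral_bmeas ?lee_fin ?lr_moment//.
    exact: bmeas_lrl.
- exact/measurable_EFinP.
- by move=> x; rewrite lee_fin lr_ge0.
Qed.

Lemma measurable_lr_mean (q : probability (Theta * Theta)%type R) :
  measurable_fun [set: sample N X Y] (fun w => \int[q]_z (lr w z)%:E)%E.
Proof.
have [m _] := bmeas_lr.
apply: (measurable_fun_fubini_tonelli_F (m2 := q) (fun x => (lr x.1 x.2)%:E)).
- exact/measurable_EFinP.
- by move=> x; rewrite lee_fin lr_ge0.
Qed.

End likelihood_ratio.

End classification.

(** * Bounds for a fixed sample *)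

Section affine.
Context d (T : measurableType d) (R : realType) (p : probability T R).

Lemma Rintegral_affine3 (h1 h2 h3 : T -> R) (c1 c2 c3 c0 : R) :
  bmeas h1 -> bmeas h2 -> bmeas h3 ->
  \int[p]_x (c1 * h1 x + c2 * h2 x + c3 * h3 x + c0) =
  c1 * (\int[p]_x h1 x) + c2 * (\int[p]_x h2 x) + c3 * (\int[p]_x h3 x) + c0.
Proof.
move=> b1 b2 b3.
have b12 : bmeas (fun x => c1 * h1 x + c2 * h2 x).
  by apply: bmeasD; exact: bmeasZ.
have b123 : bmeas (fun x => c1 * h1 x + c2 * h2 x + c3 * h3 x).
  by apply: bmeasD => //; exact: bmeasZ.
rewrite prob_RintegralD//; last exact: bmeas_cst.
rewrite prob_RintegralD//; last exact: bmeasZ.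
rewrite prob_RintegralD; [|exact: bmeasZ..].
by rewrite !prob_RintegralZ// prob_Rintegral_cst.
Qed.

Lemma Rintegral_affine4 (h1 h2 h3 h4 : T -> R) (c1 c2 c3 c4 c0 : R) :
  bmeas h1 -> bmeas h2 -> bmeas h3 -> bmeas h4 ->
  \int[p]_x (c1 * h1 x + c2 * h2 x + c3 * h3 x + c0 + c4 * h4 x) =
  c1 * (\int[p]_x h1 x) + c2 * (\int[p]_x h2 x) + c3 * (\int[p]_x h3 x) + c0
  + c4 * (\int[p]_x h4 x).
Proof.
move=> b1 b2 b3 b4.
rewrite prob_RintegralD.
- by rewrite Rintegral_affine3// prob_RintegralZ.
- by do 3?[apply: bmeasD]; [exact: bmeasZ..|exact: bmeas_cst].
- exact: bmeasZ.
Qed.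

(** Reduces an inequality to a known one with the same difference of sides, so that a ring identity
    remains. *)
Lemma le_sub (x y x' y' : R) : x <= y -> y' - x' = y - x -> x' <= y'.
Proof. by move=> xy e; rewrite -subr_ge0 e subr_ge0. Qed.

Lemma Rintegral_le_logmgf (h : T -> R) : bmeas h ->
  \int[p]_x h x <= logmgf p h.
Proof.
move=> bh; rewrite -ler_expR lnK ?posrE ?Rintegral_expR_gt0//.
exact: jensen_expR.
Qed.

End affine.

Section fixed_sample.
Context (R : realType) (N : nat) (dX dY dT : measure_display).
Context (X : measurableType dX) (Y : measurableType dY).
Context (Theta : measurableType dT).
Variables (P : probability (sample N X Y) R) (f : Theta -> X -> Y).
Hypothesis N_gt0 : (0 < N)%N.
Hypothesis Y_finite : finite_set [set: Y].
Hypothesis Y_discrete : forall A : set Y, measurable A.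
Hypothesis f_measurable :
  measurable_fun [set: (Theta * X)%type] (fun p => f p.1 p.2).
Variables (pi : probability Theta R) (w : sample N X Y).
Implicit Types (p q rho : probability Theta R) (gamma beta lam : R).

Let n : R := N%:R.
Let n0 : 0 < n. Proof. by rewrite ltr0n. Qed.

Local Notation Rk := (risk f P).
Local Notation r := (emp_risk R f w).
Local Notation m := (emp_dist R f w).

Let bR : bmeas Rk. Proof. exact: bmeas_risk. Qed.

Let br : bmeas r.
Proof. by apply: (@bmeas_emp_risk _ _ _ _ _ _ _ _ _ _ _ _ _ _ id (fun=> w)). Qed.

Let bm2 : bmeas (fun z : Theta * Theta => m z.1 z.2).
Proof. by apply: (@bmeas_emp_dist _ _ _ _ _ _ _ _ _ _ _ _ _ _ fst snd (fun=> w)). Qed.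

Let m0 th th' : 0 <= m th th'.
Proof.
by rewrite mulr_ge0 ?invr_ge0 ?ler0n// sumr_ge0// => i _; exact: normr_ge0.
Qed.

Lemma emp_distC th th' : m th th' = m th' th.
Proof. by congr (_ * _); apply: eq_bigr => i _; rewrite distrC. Qed.

Lemma emp_dist_triangle th th' th'' : m th th'' <= m th th' + m th' th''.
Proof.
rewrite -mulrDr ler_wpM2l ?invr_ge0 ?ler0n// -big_split/=.
by apply: ler_sum => i _; exact: ler_distD.
Qed.

Definition mean_dist p th : R := \int[p]_th' m th th'.

Let bm th : bmeas (m th).
Proof. by apply: (@bmeas_emp_dist _ _ _ _ _ _ _ _ _ _ _ _ _ _ (fun=> th) id (fun=> w)). Qed.

Let bmbar p : bmeas (mean_dist p).
Proof. by apply: (bmeas_Rintegral p bm2) => x; exact: m0. Qed.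

Let mbar0 p th : 0 <= mean_dist p th.
Proof. exact: Rintegral_ge0. Qed.

Let dist p q : R := \int[p]_th mean_dist q th.

Let distC p q : dist p q = dist q p.
Proof.
rewrite /dist /mean_dist (fubini_bmeas p q bm2); last by move=> x; exact: m0.
apply: eq_Rintegral => th _; apply: eq_Rintegral => th' _; exact: emp_distC.
Qed.

(** The triangle inequality for m', averaged over independent draws. It serves to insert
    pi_exp(-lambda2 r) between [rho] and [q]; note that [dist p p] need not vanish. *)
Let dist_triangle p1 p2 p3 : dist p1 p3 <= dist p1 p2 + dist p2 p3.
Proof.
have step th : mean_dist p3 th <= mean_dist p2 th + dist p2 p3.
  rewrite -prob_RintegralD//.
  apply: prob_Rintegral_ge; first exact: bmeasD.
  move=> th'; rewrite -[m th th'](prob_Rintegral_cst p3) -prob_RintegralD//;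
    last exact: bmeas_cst.
  apply: prob_le_Rintegral => //; first by apply: bmeasD => //; exact: bmeas_cst.
  by move=> th''; exact: emp_dist_triangle.
rewrite -[X in _ <= _ + X](prob_Rintegral_cst p1) -prob_RintegralD//;
  last exact: bmeas_cst.
apply: prob_le_Rintegral => //.
by apply: bmeasD => //; exact: bmeas_cst.
Qed.

Section temperature.
Variable gamma : R.
Let t : R := tanh (gamma / n).
Let c : R := n * ln (cosh (gamma / n)).

Let t1 : `|t| < 1. Proof. exact: normr_tanh_lt1. Qed.

Let c0 : 0 <= c.
Proof. by rewrite mulr_ge0 ?ler0n// ln_ge0// cosh_ge1. Qed.

Let mean_risk01 p : 0 <= \int[p]_th Rk th <= 1.
Proof.
apply/andP; split; [apply: prob_Rintegral_ge => // th|
  apply: prob_Rintegral_le => // th].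
  by have /andP[] := risk01 P N_gt0 Y_finite Y_discrete f_measurable th.
by have /andP[] := risk01 P N_gt0 Y_finite Y_discrete f_measurable th.
Qed.

Let risk01' th : 0 <= Rk th <= 1.
Proof. exact: risk01. Qed.

Let lnR q th : R := ln (1 - t * (Rk th - \int[q]_th' Rk th')).

Let lnR_lb q th : 1 - `|t| <= 1 - t * (Rk th - \int[q]_th' Rk th').
Proof. by rewrite lerD2l lerN2; exact: t_gap_lt. Qed.

Let blin q : bmeas (fun th => 1 - t * (Rk th - \int[q]_th' Rk th')).
Proof.
apply: bmeasB; first exact: bmeas_cst.
by apply: bmeasZ; apply: bmeasB => //; exact: bmeas_cst.
Qed.

Let blnR q : bmeas (lnR q).
Proof.
apply: (bmeas_ln (blin q) _ (lnR_lb q)).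
by rewrite subr_gt0.
Qed.

(* Integrating log (lr (th, .)) against q and using Jensen's inequality for
   the logarithm of 1 - t (R th - R _) leaves this function of th. *)
Definition mean_log_lr q th : R :=
  - n * lnR q th + - c * mean_dist q th + - gamma * r th
  + gamma * (\int[q]_th' r th').

Let bV q : bmeas (mean_log_lr q).
Proof.
apply: bmeasD; last exact: bmeas_cst.
by do 2?[apply: bmeasD]; exact: bmeasZ.
Qed.

Lemma lrE z : lr P f t w z =
  expR (- n * ln (1 - t * (Rk z.1 - Rk z.2)) + - c * m z.1 z.2
        + - gamma * r z.1 + gamma * r z.2).
Proof.
rewrite /lr; under eq_bigr => i _.
  rewrite /err -expR_tanh; over.
rewrite -expR_sum -expRD; congr expR.
rewrite sumrB -!mulr_sumr sumrB /c /emp_risk /emp_dist /err -/n.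
by field; rewrite gt_eqF.
Qed.

(** Jensen's inequality for exp moves the mean over the second parameter into the exponent; then
    Jensen's inequality for ln, under a negative coefficient, replaces the risk of the second
    parameter by its mean. *)
Lemma logmgf_mean_log_lr q (D : R) :
  (\int[q \x q]_z (lr P f t w z)%:E <= (expR D)%:E)%E ->
  logmgf q (mean_log_lr q) <= D.
Proof.
have bl : bmeas (lr P f t w) by exact: bmeas_lrr.
have [ml [M hM]] := bl.
have bl1 th : bmeas (fun th' => lr P f t w (th, th')).
  by split; [exact: measurable_fun_pair2|exists M => th'; exact: hM].
rewrite fubini_tonelli1; last 2 first.
- exact/measurable_EFinP.
- by move=> z; rewrite lee_fin; exact: lr_ge0.
rewrite /fubini_F; under eq_integral do rewrite integral_bmeas//.
rewrite integral_bmeas ?lee_fin; last first.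
  by apply: (bmeas_Rintegral q bl) => z; exact: lr_ge0.
rewrite -[X in _ -> _ <= X]expRK => lrD.
rewrite ler_ln ?posrE ?expR_gt0 ?Rintegral_expR_gt0//.
apply: le_trans lrD; apply: prob_le_Rintegral.
- exact: bmeas_expR.
- by apply: (bmeas_Rintegral q bl) => z; exact: lr_ge0.
move=> th.
have blin' : bmeas (fun th' => 1 - t * (Rk th - Rk th')).
  apply: bmeasB; first exact: bmeas_cst.
  by apply: bmeasZ; apply: bmeasB => //; exact: bmeas_cst.
have lb th' : 1 - `|t| <= 1 - t * (Rk th - Rk th').
  by rewrite lerD2l lerN2; exact: t_gap_lt.
have t10 : 0 < 1 - `|t| by rewrite subr_gt0.
have bln' := bmeas_ln blin' t10 lb.
pose U th' := - n * ln (1 - t * (Rk th - Rk th')) + - c * m th th'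
  + gamma * r th' + - gamma * r th.
have bU : bmeas U.
  apply: bmeasD; last exact: bmeas_cst.
  by do 2?[apply: bmeasD]; exact: bmeasZ.
have -> : \int[q]_th' lr P f t w (th, th') = \int[q]_th' expR (U th').
  by apply: eq_Rintegral => th' _; rewrite lrE/=; congr expR; rewrite /U; ring.
apply: le_trans (jensen_expR q bU); rewrite ler_expR /U.
rewrite Rintegral_affine3// /mean_log_lr /mean_dist.
have : \int[q]_th' ln (1 - t * (Rk th - Rk th')) <= lnR q th.
  apply: (le_trans (jensen_ln q blin' t10 lb)); rewrite /lnR.
  rewrite (_ : \int[q]_th' (1 - t * (Rk th - Rk th')) =
    1 - t * (Rk th - \int[q]_th' Rk th'))//.
  rewrite prob_RintegralB; last 2 first.
  - exact: bmeas_cst.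
  - by apply: bmeasZ; apply: bmeasB => //; exact: bmeas_cst.
  rewrite prob_RintegralZ; last by apply: bmeasB => //; exact: bmeas_cst.
  rewrite prob_RintegralB//; last exact: bmeas_cst.
  by rewrite !prob_Rintegral_cst.
by rewrite -(ler_pM2l n0); lra.
Qed.

Variables (beta D : R).
Let a th : R := - beta * Rk th.
Let q := gibbs pi a.
Hypothesis q_lr : logmgf q (mean_log_lr q) <= D.

Let b lam th : R := - lam * r th.
Let pg lam := emp_gibbs f pi w lam.
Let gap rho := \int[rho]_th Rk th - \int[q]_th Rk th.
Let mean rho := \int[rho]_th r th.

Let ba : bmeas a. Proof. exact: bmeasZ. Qed.
Let bb lam : bmeas (b lam). Proof. exact: bmeasZ. Qed.
Let bM rho : bmeas (fun th => c * mean_dist rho th). Proof. exact: bmeasZ. Qed.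
Let bbM lam rho : bmeas (fun th => b lam th + c * mean_dist rho th).
Proof. exact: bmeasD. Qed.

Let log_lapE lam rho : log_lap f pi w gamma lam rho =
  logmgf pi (fun th => b lam th + c * mean_dist rho th) - logmgf pi (b lam).
Proof. by rewrite -logmgf_gibbs. Qed.

(* ring compares atoms up to conversion, which is costly for integrals. *)
Ltac ring_atoms := repeat match goal with
  | |- context [F ?k ?g ?s ?x] => generalize (F k g s x)
  | |- context [ln ?x] => generalize (ln x)
  | |- context [logmgf ?p ?h] => generalize (logmgf p h)
  | |- context [log_lap ?g ?p ?v ?x ?l ?s] => generalize (log_lap g p v x l s)
  | |- context [dist ?p ?p'] => generalize (dist p p')
  | |- context [mean ?p] => generalize (mean p)
  | |- context [Rintegral ?p ?S ?h] => generalize (Rintegral p S h)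
  end; generalize c n; intros; ring.

(** The Gibbs variational principle with [p] as trial measure; it is used with [p] the Gibbs prior
    and with [p] an empirical Gibbs measure. *)
Let log_lap_ge p lam rho (h : Theta -> R) : bmeas h -> p = gibbs pi h ->
  logmgf pi h + (c * dist p rho + - lam * mean p - \int[p]_th h th)
    - logmgf pi (b lam) <= log_lap f pi w gamma lam rho.
Proof.
move=> bh ->; rewrite log_lapE lerD2r.
have := gibbs_variational pi bh (bbM lam rho).
rewrite (_ : \int[gibbs pi h]_x _ = \int[gibbs pi h]_th (c * mean_dist rho th +
  - lam * r th + -1 * h th + 0)).
  rewrite Rintegral_affine3// => /le_sub; apply.
  by rewrite -/(mean _) -/(dist _ _); ring_atoms.
by apply: eq_Rintegral => th _; rewrite /b; ring.
Qed.

Let int_a p : \int[p]_th a th = - beta * (\int[p]_th Rk th).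
Proof. exact: prob_RintegralZ. Qed.

Let int_b p lam : \int[p]_th b lam th = - lam * mean p.
Proof. exact: prob_RintegralZ. Qed.

Let log_lap_ge_q lam rho :
  logmgf pi a - logmgf pi (b lam) + c * dist rho q - lam * mean q
    + beta * (\int[q]_th Rk th) <= log_lap f pi w gamma lam rho.
Proof.
have := @log_lap_ge q lam rho a ba erefl.
by rewrite int_a distC => /le_sub; apply; ring_atoms.
Qed.

Lemma log_lap_ge0 lam rho : 0 <= log_lap f pi w gamma lam rho.
Proof. by apply: logmgf_ge0 => [|th]; [exact: (bM rho)|exact: mulr_ge0 c0 (mbar0 rho th)]. Qed.

(** * Bounds for one posterior, with [k] in the role of the entropy of [rho] relative to pi_exp(-lam
    r) *)

Section posterior.
Variables (rho : probability Theta R) (lam k : R).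
Hypothesis rho_dv :
  forall h, bmeas h -> \int[rho]_th h th <= k + logmgf (pg lam) h.

(** The test function [h] is chosen so that [b lam + h] equals [a] plus [mean_log_lr q]: the
    log-Laplace transform on the right is then controlled by [q_lr]. Jensen's inequality for ln
    brings the mean over [rho] inside. *)
Let gap_le_KL : - (n * ln (1 - t * gap rho)) <=
  gamma * (mean rho - mean q) + c * dist rho q
  + beta * (\int[rho]_th Rk th) - lam * mean rho
  + k + D + logmgf pi a - logmgf pi (b lam).
Proof.
pose h th : R := - n * lnR q th + - c * mean_dist q th + (lam - gamma) * r th
  + gamma * mean q + - beta * Rk th.
have bh : bmeas h.
  by do 4?[apply: bmeasD]; [exact: bmeasZ..|exact: bmeas_cst|exact: bmeasZ].
have := rho_dv bh; rewrite logmgf_gibbs//; last exact: bb.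
rewrite (_ : logmgf pi (fun x => _ + _) = logmgf q (mean_log_lr q) + logmgf pi a);
  last first.
  rewrite logmgf_gibbs// subrK; congr logmgf; apply/funext => th.
  by rewrite /mean_log_lr /h /a /b /mean; ring.
rewrite Rintegral_affine4// -/(mean rho) -/(dist rho q).
have : \int[rho]_th lnR q th <= ln (1 - t * gap rho).
  apply: (le_trans (jensen_ln rho (blin q) _ (lnR_lb q))).
    by rewrite subr_gt0.
  rewrite prob_RintegralB; last 2 first.
  - exact: bmeas_cst.
  - by apply: bmeasZ; apply: bmeasB => //; exact: bmeas_cst.
  rewrite prob_RintegralZ; last by apply: bmeasB => //; exact: bmeas_cst.
  rewrite prob_RintegralB//; last exact: bmeas_cst.
  by rewrite !prob_Rintegral_cst.
rewrite -(ler_pM2l n0) => h1 h2.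
have := lerD (lerD h1 h2) q_lr => /le_sub; apply.
by rewrite -/(b lam) /gap; ring_atoms.
Qed.

(** Adding [log_lap_ge_q] cancels [dist rho q] and the normalising constants; on the right only
    [mean q] remains unobservable. *)
Lemma F_gap_le_prior :
  F N gamma beta (gap rho) <=
  k + (gamma - lam) * (mean rho - mean q) + log_lap f pi w gamma lam rho + D.
Proof.
have := lerD (log_lap_ge_q lam rho) gap_le_KL => /le_sub; apply.
by rewrite FE -/n -/t /gap; ring_atoms.
Qed.

(** The triangle inequality splits [dist rho q] at [pg lam2]. One log-Laplace term absorbs each
    half, with trial measures [pg lam2] and [q], and the unobservable difference keeps the
    coefficient gamma - lam2. *)
Lemma F_gap_le_two_temperatures lam2 :
  F N gamma beta (gap rho) <=
  k + (gamma - lam) * (mean rho - mean (pg lam2))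
  + log_lap f pi w gamma lam rho + D
  + (log_lap f pi w gamma lam2 (pg lam2)
     - (lam2 - gamma) * (mean (pg lam2) - mean q)).
Proof.
have h1 := @log_lap_ge (pg lam2) lam rho (b lam2) (bb lam2) erefl.
rewrite int_b (distC (pg lam2) rho) in h1.
have h2 := log_lap_ge_q lam2 (pg lam2).
have h3 : c * dist rho q <= c * (dist rho (pg lam2) + dist (pg lam2) q).
  by rewrite ler_wpM2l.
have := lerD (lerD h1 h2) (lerD h3 gap_le_KL).
move=> /le_sub; apply.
by rewrite FE -/n -/t /gap; ring_atoms.
Qed.

End posterior.

(** [F_gap_le_prior] at the empirical Gibbs measure itself, where Jensen's inequality allows k =
    0. *)
Lemma F_gap_emp_gibbs lam :
  F N gamma beta (gap (pg lam)) <=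
  (gamma - lam) * (mean (pg lam) - mean q)
  + log_lap f pi w gamma lam (pg lam) + D.
Proof.
have := @F_gap_le_prior (pg lam) lam 0; rewrite add0r; apply => h bh.
by rewrite add0r; exact: Rintegral_le_logmgf.
Qed.

(** Sum of the two Gibbs variational inequalities between the exponents - beta R and - lam r: the
    log normalising constants cancel. *)
Lemma mean_gap_le lam :
  lam * (mean (pg lam) - mean q) <= beta * gap (pg lam).
Proof.
have e1 p : \int[p]_th (b lam th - a th) =
    - lam * mean p - - beta * (\int[p]_th Rk th).
  by rewrite prob_RintegralB// int_a int_b.
have e2 p : \int[p]_th (a th - b lam th) =
    - beta * (\int[p]_th Rk th) - - lam * mean p.
  by rewrite prob_RintegralB// int_a int_b.
have h1 := gibbs_variational pi ba (bb lam).
have h2 := gibbs_variational pi (bb lam) ba.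
have := lerD (eq_ind _ (fun z => z <= _) h1 _ (e1 q))
  (eq_ind _ (fun z => z <= _) h2 _ (e2 (pg lam))).
by move=> /le_sub; apply; rewrite /gap; ring_atoms.
Qed.

Lemma gap_lt1 rho : t * gap rho < 1.
Proof. by apply: (le_lt_trans _ t1); exact: t_gap_lt. Qed.

Lemma F_gap_le_term rho (l : R * R) : 0 < beta -> 0 < gamma -> 0 <= D ->
  lambda_range N beta gamma l ->
  ((F N gamma beta (gap rho))%:E <=
   common_terms f pi w rho gamma l.1 l.2 + D%:E
   + ((gamma - l.1) * (beta / l.2)
      * Finv N gamma (beta * gamma / l.2)
          (log_lap f pi w gamma l.2 (pg l.2) + D)%:E)%:E)%E.
Proof.
move=> beta0 gamma0 D0 [].
set l1 := l.1; set l2 := l.2 => l10 l1g l2lb.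
have t0 : 0 < t by rewrite tanh_gt0// divr_gt0.
have l20 : 0 < l2.
  by apply: le_lt_trans l2lb; rewrite !mulr_ge0 ?invr_ge0 ?ltW.
have an : beta * gamma / l2 < n * t.
  move: l2lb; rewrite -mulrA -invfM ltr_pdivrMr ?(mulr_gt0 n0 t0)//.
  by rewrite ltr_pdivrMr// [ltRHS]mulrC.
set y := Finv _ _ _ _; rewrite /common_terms.
have dv h : bmeas h ->
    ((\int[rho]_th h th)%:E <= KL rho (pg l1) + (logmgf (pg l1) h)%:E)%E.
  exact: (donsker_varadhan rho (pg l1)).
have L2_ge0 := log_lap_ge0 l2 (pg l2).
case: (KL rho _) dv => [k| |] dv.
- rewrite -!EFinD lee_fin.
  have dvk h : bmeas h -> \int[rho]_th h th <= k + logmgf (pg l1) h.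
    by move=> /dv; rewrite -EFinD lee_fin.
  (* If the first entry of the minimum in [gap_transfer] exceeds the target, the second one does
     not, and the bound through two temperatures concludes. *)
  have [yl|yl] := leP ((gamma - l1) * (mean (pg l2) - mean q))
      ((gamma - l1) * (beta / l2) * y).
    have := lerD (F_gap_le_prior dvk) yl => /le_sub; apply.
    by rewrite -/(mean rho) -/(mean (pg l2)); generalize y; ring_atoms.
  have := gap_transfer N_gt0 gamma0 beta0 l20 l1g an (gap_lt1 (pg l2)) D0 L2_ge0
    (F_gap_emp_gibbs l2) (mean_gap_le l2).
  rewrite -/y ge_min leNgt yl/= => yl'.
  have := lerD (F_gap_le_two_temperatures dvk l2) yl' => /le_sub; apply.
  by rewrite -/(mean rho) -/(mean (pg l2)); generalize y; ring_atoms.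
- by rewrite !addye ?leey.
(* The zero test function shows that the entropy is not -oo. *)
- by have := dv _ (bmeas_cst Theta 0); rewrite addNye leeNy_eq.
Qed.

End temperature.

End fixed_sample.

(** * The theorem *)

Section weights.
Context (R : realType) (nu : probability (measurableTypeR R) R) (eps : R).
Hypothesis eps01 : 0 < eps < 1.

(** In the first case [D] is nonnegative because the weight is at most 1; in the second the weight
    vanishes and minus its logarithm is +oo. *)
Variant log_weight_spec (beta gamma : R) : \bar R -> Prop :=
| LogWeightFin D of 0 <= D & (0 < nu [set beta])%E & (0 < nu [set gamma])%E &
    (eps%:E * nu [set beta] * nu [set gamma])%E = (expR (- D))%:E :
    log_weight_spec beta gamma (- D)%:E
| LogWeightNy : log_weight_spec beta gamma -oo%E.

Lemma log_weightP beta gamma :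
  log_weight_spec beta gamma (log_weight nu eps beta gamma).
Proof.
have /andP[eps0 eps1] := eps01.
have fnu x : nu [set x] = (fine (nu [set x]))%:E.
  by rewrite fineK// fin_num_measure.
have nu0 x : 0 <= fine (nu [set x]) by rewrite fine_ge0.
have nu1 x : fine (nu [set x]) <= 1.
  by rewrite -lee_fin -fnu probability_le1.
rewrite /log_weight; set x := (_ * _ * _)%E.
have xE : x = (eps * fine (nu [set beta]) * fine (nu [set gamma]))%:E.
  by rewrite /x 2!EFinM -!fnu.
have x1 : eps * fine (nu [set beta]) * fine (nu [set gamma]) <= 1.
  by rewrite !mulr_ile1 ?mulr_ge0 ?(ltW eps0) ?(ltW eps1).
have [x0|x0] := leP (eps * fine (nu [set beta]) * fine (nu [set gamma])) 0.
  by rewrite xE le0_lneNy ?lee_fin//; exact: LogWeightNy.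
rewrite xE lne_EFin//.
rewrite -[X in X%:E]opprK; apply: LogWeightFin.
- by rewrite oppr_ge0 ln_le0.
- rewrite fnu lte_fin lt_neqAle nu0 andbT; apply: contraTneq x0 => <-.
  by rewrite mulr0 mul0r ltxx.
- rewrite fnu lte_fin lt_neqAle nu0 andbT; apply: contraTneq x0 => <-.
  by rewrite mulr0 ltxx.
- by rewrite opprK lnK ?posrE// -xE.
Qed.

Lemma unweight (x y W : \bar R) (D : R) : 0 < eps ->
  (x \is a fin_num -> y \is a fin_num -> 0 < x -> 0 < y -> 0 <= W ->
   eps%:E * x * y = (expR (- D))%:E ->
   x * y * W <= (eps^-1)%:E -> W <= (expR D)%:E)%E.
Proof.
move=> eps0; case: x => // x; case: y => // y _ _; rewrite !lte_fin => x0 y0.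
have xy0 := mulr_gt0 x0 y0.
case: W => [W| |]// _; last by rewrite -EFinM mulry gtr0_sg// mul1e leye_eq.
rewrite -!EFinM !lee_fin => -[e] h.
rewrite -[expR D]invrK -expRN -e -(ler_pM2l xy0) (le_trans h)//.
by rewrite -[eps * x * y]mulrA invfM mulrCA divff ?gt_eqF// mulr1.
Qed.

Lemma weighted_le (C : \bar R) (x L co D : R) : x <= co * (L + D) ->
  (C - (- D)%:E + x%:E <= C + (co * L)%:E - (1 + co)%:E * (- D)%:E)%E.
Proof.
move=> xle; rewrite -EFinM mulrN -!EFinN !opprK -!addeA -!EFinD leeD2l//.
by rewrite lee_fin mulrDl mul1r; lra.
Qed.

Lemma weight0_le (C : \bar R) (x y co : R) : 0 <= co ->
  (C - -oo + x%:E <= C + y%:E - (1 + co)%:E * -oo)%E.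
Proof.
move=> co0; rewrite gt0_muleNy ?lte_fin ?ltr_wpDr//.
by case: C => [c| |]//=; rewrite leey.
Qed.

End weights.

Section theorem.
Context (R : realType) (N : nat) (dX dY dT : measure_display).
Context (X : measurableType dX) (Y : measurableType dY).
Context (Theta : measurableType dT).
Variables (f : Theta -> X -> Y) (pi : probability Theta R).
Variables (nu : probability (measurableTypeR R) R) (eps : R).
Hypothesis N_gt0 : (0 < N)%N.
Hypothesis eps01 : 0 < eps < 1.
Hypothesis Y_finite : finite_set [set: Y].
Hypothesis Y_discrete : forall A : set Y, measurable A.
Hypothesis f_measurable :
  measurable_fun [set: (Theta * X)%type] (fun p => f p.1 p.2).

Let n : R := N%:R.
Let n0 : 0 < n. Proof. by rewrite ltr0n. Qed.

Section bounds.
Variables (w : sample N X Y) (rho : probability Theta R) (beta gamma : R).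
Hypotheses (beta0 : 0 < beta) (gamma0 : 0 < gamma).

Let t0 : 0 < tanh (gamma / n).
Proof. by rewrite tanh_gt0// divr_gt0. Qed.

Let lambda2_gt0 l : lambda_range N beta gamma l -> 0 < l.2.
Proof.
move=> [_ _]; apply: le_lt_trans.
by rewrite !mulr_ge0 ?invr_ge0 ?(ltW beta0) ?(ltW gamma0) ?(ltW t0) ?ler0n.
Qed.

Let alpha_lt l : lambda_range N beta gamma l ->
  beta * gamma / l.2 < n * tanh (gamma / n).
Proof.
move=> lr; have l20 := lambda2_gt0 lr; case: lr => _ _.
rewrite -mulrA -invfM ltr_pdivrMr ?(mulr_gt0 n0 t0)// => lb.
by rewrite ltr_pdivrMr// [ltRHS]mulrC.
Qed.

Lemma bound_le_explicit_bound :
  (bound f pi nu eps w rho beta gamma <=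
   explicit_bound f pi nu eps w rho beta gamma)%E.
Proof.
apply: le_ereal_inf_tmp => _ [l lr <-].
apply: (le_trans (ereal_inf_lbound _)); first by exists l.
have l20 := lambda2_gt0 lr; have an := alpha_lt lr.
have [_ l1g _] := lr.
set co := coef N beta gamma l.1 l.2.
have den : 0 < n * tanh (gamma / n) - beta * gamma / l.2 by rewrite subr_gt0.
(* This form exhibits the denominator n t - alpha of [Finv_le], with alpha = beta gamma /
   lambda2. *)
have coE : co = (gamma - l.1) * (beta / l.2) /
    (n * tanh (gamma / n) - beta * gamma / l.2).
  have dn : n / gamma * tanh (gamma / n) - beta / l.2 =
      (n * tanh (gamma / n) - beta * gamma / l.2) / gamma.
    by field; rewrite !gt_eqF.
  have simpl_frac (x y b g d : R) : y != 0 -> g != 0 -> d != 0 ->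
      b / y * ((1 - x / g) * (g / d)) = (g - x) * (b / y) / d.
    by move=> y0 g0 d0; field; rewrite y0 g0 d0.
  by rewrite /co /coef -/n dn invf_div simpl_frac// gt_eqF.
have co0 : 0 <= co.
  by rewrite coE !mulr_ge0 ?invr_ge0 ?subr_ge0// ltW.
set L := log_lap _ _ _ _ _ _.
have L0 : 0 <= L by exact: log_lap_ge0.
set C := common_terms _ _ _ _ _ _ _.
clearbody C L.
case: (log_weightP nu eps01 beta gamma) => [D D0 _ _ _|]; last first.
  exact: weight0_le.
apply: weighted_le; rewrite -EFinN opprK -EFinD.
rewrite [co]coE [leRHS]mulrAC -[leRHS]mulrA ler_wpM2l//.
  by rewrite mulr_ge0 ?subr_ge0// ltW// divr_gt0.
exact: (Finv_le N_gt0 gamma0 an (addr_ge0 L0 D0)).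
Qed.

End bounds.

Lemma F_risk_gap_le_bound (P : probability (sample N X Y) R) (w : sample N X Y)
    (rho : probability Theta R) (beta gamma : R)
    (q := gibbs pi (fun th => - beta * risk f P th)) :
  0 < beta -> 0 < gamma ->
  ((0 < nu [set beta]) -> (0 < nu [set gamma]) ->
    nu [set beta] * nu [set gamma] *
    \int[q \x q]_z (lr P f (tanh (gamma / n)) w z)%:E <= (eps^-1)%:E)%E ->
  ((F N gamma beta (risk_gap f pi P beta rho))%:E <=
     bound f pi nu eps w rho beta gamma)%E.
Proof.
move=> beta0 gamma0 Wle; apply: le_ereal_inf_tmp => _ [l lrange <-].
have /andP[eps0 _] := eps01.
move: (log_weightP nu eps01 beta gamma); move: (log_weight _ _ _ _) => lw.
case=> [D D0 nub nug nuE|].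
- have -> : (- (- D)%:E = D%:E :> \bar R)%E by rewrite -EFinN opprK.
  apply: (F_gap_le_term N_gt0 Y_finite Y_discrete f_measurable
    _ rho beta0 gamma0 D0 lrange).
  apply: logmgf_mean_log_lr => //.
  have W0 : (0 <= \int[q \x q]_z (lr P f (tanh (gamma / n)) w z)%:E)%E.
    apply: integral_ge0 => z _; rewrite lee_fin; apply: lr_ge0 => //.
    exact: normr_tanh_lt1.
  by apply: (unweight eps0 _ _ nub nug W0 nuE (Wle nub nug)); exact: fin_num_measure.
(* With zero weight the bound is +oo as soon as the other terms are not -oo, which the zero test
   function guarantees. *)
- suff : (common_terms f pi w rho gamma l.1 l.2 != -oo)%E.
    by case: (common_terms _ _ _ _ _ _ _) => [c| |]//= _; rewrite leey.
  have /(_ _ (bmeas_cst Theta 0)) := @donsker_varadhan _ _ _ rho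
    (emp_gibbs f pi w l.1).
  by rewrite /common_terms; case: (KL _ _).
Qed.

End theorem.

Unset Implicit Arguments.

Theorem theorem2p1p3 (R : realType) (N : nat) (dX dY dT : measure_display)
    (X : measurableType dX) (Y : measurableType dY)
    (Theta : measurableType dT)
    (Pi : 'I_N -> probability (X * Y)%type R)
    (P : probability (sample N X Y) R)
    (f : Theta -> X -> Y)
    (pi : probability Theta R)
    (nu : probability (measurableTypeR R) R)
    (eps : R)
    (N_gt0 : (0 < N)%N)
    (X_cg : countably_generated X)
    (Theta_cg : countably_generated Theta)
    (Y_finite : finite_set [set: Y])
    (Y_discrete : forall A : set Y, measurable A)
    (P_product : is_product_measure Pi P)
    (f_measurable :
      measurable_fun [set: (Theta * X)%type] (fun p => f p.1 p.2))
    (eps_in01 : 0 < eps < 1)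
    (nu_Rplus : nu [set x | 0 <= x] = 1%E)
    (nu_atomic : atomic nu) :
  (exists A : set (sample N X Y),
    [/\ measurable A, ((1 - eps)%:E <= P A)%E &
      forall (rho : R.-pker (sample N X Y) ~> Theta) (beta gamma : R)
          (w : sample N X Y),
        0 < beta -> 0 < gamma -> A w ->
        (N%:R * tanh (gamma / N%:R) - beta) * risk_gap f pi P beta (kernel_at rho w)
          <= F N gamma beta (risk_gap f pi P beta (kernel_at rho w))
        /\ ((F N gamma beta (risk_gap f pi P beta (kernel_at rho w)))%:E
              <= bound f pi nu eps w (kernel_at rho w) beta gamma)%E])
  /\ (forall (rho : R.-pker (sample N X Y) ~> Theta) (beta gamma : R)
        (w : sample N X Y),
      0 < beta -> 0 < gamma ->
      (bound f pi nu eps w (kernel_at rho w) beta gamma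
         <= explicit_bound f pi nu eps w (kernel_at rho w) beta gamma)%E).
Proof.
have /andP[eps0 eps1] := eps_in01; split; last first.
  (* This comparison is deterministic: it holds at every sample point. *)
  move=> rho beta gamma w beta0 gamma0.
  exact: bound_le_explicit_bound.
pose q b := gibbs pi (fun th => - b * risk f P th).
(* For each pair (b, g) the ratio is averaged over two independent draws from the sample-free Gibbs
   prior [q b]. No posterior occurs in this average, so one event serves all of them. *)
have [|||A [mA PA AW]] := @uniform_over_atoms _ _ _ P nu
  (fun b g w => \int[q b \x q b]_z (lr P f (tanh (g / N%:R)) w z)%:E)%E eps
  nu_atomic eps0.
- move=> b g; apply: measurable_lr_mean => //; exact: normr_tanh_lt1.
- move=> b g w; apply: integral_ge0 => z _; rewrite lee_fin.
  by apply: lr_ge0 => //; exact: normr_tanh_lt1.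
- move=> b g; apply: (lr_mean _ _ _ _ _ P_product) => //.
  exact: normr_tanh_lt1.
exists A; split => // rho beta gamma w beta0 gamma0 Aw; split.
  by apply: F_ge => //; exact: gap_lt1.
by apply: F_risk_gap_le_bound => // nub nug; exact: AW.
Qed.
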